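(* Let $\nu\in\mathbb{N}$ with $\nu>1$ and assume $\mathcal{J}=\{\Phi\in\mathcal{S}_+^m(\mathbb{T}):\int G\Phi G^*=I\}$ is non-empty. Then the dual problem $$\max\{J_\nu(\Lambda):\Lambda\in\mathcal{L}_+\},\qquad J_\nu(\Lambda)=\frac{\nu}{1-\nu}\int\operatorname{tr}\Big[\Big(I+\tfrac{1}{\nu}W_\Psi^*G^*\Lambda GW_\Psi\Big)^{1-\nu}\Big]-\operatorname{tr}[\Lambda],$$ admits a unique solution $\Lambda^\circ$, and it satisfies $\int G\,\Phi_\nu(\Lambda^\circ)\,G^*=I$, where $\Phi_\nu(\Lambda)=W_\Psi\big(I+\tfrac{1}{\nu}W_\Psi^*G^*\Lambda GW_\Psi\big)^{-\nu}W_\Psi^*$.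
   Context: Integration $\int f$ denotes $\frac{1}{2\pi}\int_{-\pi}^{\pi} f(e^{j\vartheta})\,d\vartheta$; a star denotes conjugate transpose. $\mathcal{S}_+^m(\mathbb{T})$: measurable, bounded, coercive, Hermitian $\mathbb{C}^{m\times m}$-valued spectral densities on the unit circle $\mathbb{T}$. $\Psi\in\mathcal{S}_+^m(\mathbb{T})$ is rational, with canonical left spectral factor $W_\Psi$ (outer, $\det W_\Psi\neq0$ on $\{|z|\ge1\}$, $W_\Psi(\infty)$ lower triangular with positive diagonal, $\Psi=W_\Psi W_\Psi^*$ on $\mathbb{T}$). $\mathcal{Q}_n$: real symmetric $n\times n$ matrices. Data: $n>m$, $A\in\mathbb{R}^{n\times n}$ with all eigenvalues in the open unit disk, $B\in\mathbb{R}^{n\times m}$ of full column rank, $(A,B)$ reachable, $\hat\Sigma\in\mathcal{Q}_n$ positive definite, $G(z)=\hat\Sigma^{-1/2}(zI-A)^{-1}B$. $\mathcal{Q}_n^G:=\{\int G\Phi G^*:\Phi\in\mathcal{V}(\mathcal{S}_+^m(\mathbb{T}))\}$ with $\mathcal{V}(\cdot)$ the real linear span; $\mathcal{L}_+:=\{\Lambda\in\mathcal{Q}_n^G: I+\tfrac1\nu W_\Psi^*G^*\Lambda GW_\Psi\succ0\text{ on }\mathbb{T}\}$. *)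

(* Defs.v *)
From HB Require Import structures.
From mathcomp Require Import all_boot all_order all_algebra.
From mathcomp Require Import all_classical all_reals all_analysis.
From mathcomp Require Import complex.
Set Implicit Arguments. Unset Strict Implicit. Unset Printing Implicit Defensive.
Import Order.TTheory GRing.Theory Num.Theory.
Local Open Scope ring_scope.

Section Defs.
Variable R : realType.
Local Notation C := R[i].

Definition toC (x : R) : C := Complex x 0.
Definition expi (t : R) : C := Complex (cos t) (sin t).
Definition onT (z : C) : Prop := `|z| = 1.

Definition ctr p q (M : 'M[C]_(p, q)) : 'M[C]_(q, p) := map_mx Num.conj M^T.

Definition circ_intR (f : C -> R) : R :=
  (2 * pi)^-1 * Rintegral (@lebesgue_measure R) `[- pi, pi]%classic (f \o expi).
Definition circ_int (f : C -> C) : C :=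
  Complex (circ_intR (fun z => complex.Re (f z))) (circ_intR (fun z => complex.Im (f z))).
Definition circ_intmx p q (F : C -> 'M[C]_(p, q)) : 'M[C]_(p, q) :=
  \matrix_(i, j) circ_int (fun z => F z i j).

Definition mxpow (K : pzRingType) k (M : 'M[K]_k) (e : nat) : 'M[K]_k :=
  iter e (mulmx M) 1%:M.

Definition cpsd k (M : 'M[C]_k) : Prop :=
  forall x : 'cV[C]_k, 0 <= (ctr x *m M *m x) 0 0.
Definition cpd k (M : 'M[C]_k) : Prop :=
  forall x : 'cV[C]_k, x != 0 -> 0 < (ctr x *m M *m x) 0 0.
Definition hermitian k (M : 'M[C]_k) : Prop := ctr M = M.

Definition rposdef k (S : 'M[R]_k) : Prop :=
  S^T = S /\ forall x : 'cV[R]_k, x != 0 -> 0 < (x^T *m S *m x) 0 0.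

Definition spec_density k (Phi : C -> 'M[C]_k) : Prop :=
  [/\ (forall i j, measurable_fun setT (fun t : R => complex.Re (Phi (expi t) i j)) /\
                   measurable_fun setT (fun t : R => complex.Im (Phi (expi t) i j))),
      (exists M : R, forall z, onT z -> forall i j, `|Phi z i j| <= toC M),
      (exists eps : R, 0 < eps /\ forall z, onT z -> cpsd (Phi z - (toC eps)%:M)) &
      (forall z, onT z -> hermitian (Phi z))].

(* reachability of (A, B): the columns of A^k B, k < n, span R^n (Kalman) *)
Definition reachable n m (A : 'M[R]_n) (B : 'M[R]_(n, m)) : Prop :=
  (1%:M <= \sum_(k < n) <<(mxpow A k *m B)^T>>)%MS.

(* rational matrix function N(z)/d(z) and its value at infinity *)
Definition ratmx_eval k (N : 'M[{poly C}]_k) (d : {poly C}) (z : C) : 'M[C]_k :=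
  \matrix_(i, j) ((N i j).[z] / d.[z]).
Definition ratmx_inf k (N : 'M[{poly C}]_k) (d : {poly C}) : 'M[C]_k :=
  \matrix_(i, j) ((N i j)`_(size d).-1 / lead_coef d).

(* W = N/d is the canonical left spectral factor (of W W^* on T):
   proper rational, analytic on |z| >= 1 (poles in the open disk), outer
   (det W <> 0 on |z| >= 1), W(oo) lower triangular with positive diagonal *)
Definition canonical_factor k (N : 'M[{poly C}]_k) (d : {poly C}) : Prop :=
  [/\ forall z : C, 1 <= `|z| -> d.[z] != 0,
      forall i j, (size (N i j) <= size d)%N,
      forall z : C, 1 <= `|z| -> \det (ratmx_eval N d z) != 0,
      forall i j : 'I_k, (i < j)%N -> ratmx_inf N d i j = 0 &
      forall i : 'I_k, 0 < ratmx_inf N d i i].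

(* G(z) = Sigma^{-1/2} (zI - A)^{-1} B, with Shalf = Sigma^{-1/2} *)
Definition Gfun n m (Shalf A : 'M[R]_n) (B : 'M[R]_(n, m)) (z : C) : 'M[C]_(n, m) :=
  map_mx toC Shalf *m invmx (z%:M - map_mx toC A) *m map_mx toC B.

Definition in_QG n m (G : C -> 'M[C]_(n, m)) (L : 'M[C]_n) : Prop :=
  exists (K : nat) (c : 'I_K -> R) (Phis : 'I_K -> C -> 'M[C]_m),
    (forall k, spec_density (Phis k)) /\
    L = circ_intmx (fun z => G z *m (\sum_(k < K) toC (c k) *: Phis k z) *m ctr (G z)).

Definition Mnu n m (nu : nat) (G : C -> 'M[C]_(n, m)) (W : C -> 'M[C]_m)
    (L : 'M[C]_n) (z : C) : 'M[C]_m :=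
  1%:M + (toC (nu%:R))^-1 *: (ctr (W z) *m ctr (G z) *m L *m G z *m W z).

Definition Lplus n m nu G W (L : 'M[C]_n) : Prop :=
  in_QG G L /\ forall z, onT z -> cpd (@Mnu n m nu G W L z).

(* J_nu (real-valued; Re is taken of quantities that are real) *)
Definition Jnu n m (nu : nat) G W (L : 'M[C]_n) : R :=
  (nu%:R / (1 - nu%:R)) *
    circ_intR (fun z => complex.Re (\tr (invmx (mxpow (@Mnu n m nu G W L z) (nu - 1)))))
  - complex.Re (\tr L).

Definition Phinu n m (nu : nat) G W (L : 'M[C]_n) (z : C) : 'M[C]_m :=
  W z *m invmx (mxpow (@Mnu n m nu G W L z) nu) *m ctr (W z).

End Defs.

(* Main.v *)
Require Import Defs.
From HB Require Import structures.
From mathcomp Require Import all_boot all_order all_algebra.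
From mathcomp Require Import all_classical all_reals all_analysis.
From mathcomp Require Import complex measurable_realfun.
From mathcomp Require Import ring lra.
Import Order.TTheory GRing.Theory Num.Theory numFieldNormedType.Exports.
Local Open Scope ring_scope.
Set Implicit Arguments. Unset Strict Implicit. Unset Printing Implicit Defensive.
(** Write [M(L) = I + nu^-1 W^* G^* L G W]. Klein's identity for the trace
    function [M |-> tr M^(1-nu)], read off the spectral decompositions of
    [M(L)] and [M(L')], gives

      J(L') = J(L) + tr ((L' - L) D(L)) - nu/(nu-1) int klein(M(L), M(L')),

    with [D(L) = int G Phi_nu(L) G^* - I] and a remainder comparable to
    [tr (M(L') - M(L))^2]. Hence a critical point is a global maximum, and it is
    unique since [X] in the moment space with [G^* X G = 0] on the circle is
    orthogonal to itself. At a maximum, moving in the direction [D(L)], which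
    lies in the moment space, forces [tr D(L)^2 <= 0].

    For existence, a feasible density [Phi0] turns [tr L] into
    [int tr (G^* L G Phi0)], which bounds both [L] and [int tr M^(1-nu)] on the
    superlevel set of [J(0)]. As [M(L)] is then uniformly Lipschitz on the
    circle, an eigenvalue [q] at one point makes [int tr M^(1-nu)] at least of
    order [log (1/q)], so [M(L)] stays uniformly away from singularity and the
    superlevel set lies in a compact subset of the domain of [J]. *)

(** Nothing is differentiated. Concavity, continuity, the first-order condition and uniqueness all
    come from lower and upper bounds on the Klein remainder. [M(L)] and [M(L')] need not commute,
    but every trace involved is a double sum over pairs of eigenvalues with the same nonnegative
    weights, so these bounds reduce to inequalities between real numbers.

    The obstacle is the boundary of the open domain, where a maximizing sequence could degenerate.
    The circle has dimension one, so [1/(q + k|t|)] has an integral that diverges as [q] tends to 0.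
    Lipschitz dependence on the angle is therefore exactly enough when the exponent [nu - 1] is 1,
    and a larger exponent only helps, since [x^(nu-1) >= x - 1] for [x >= 0]. This is where [nu > 1]
    enters the barrier.

    Rationality and the location of the poles matter only through two consequences: [G] and [W] are
    bounded and Lipschitz on the circle, and [W] is invertible there. Feasibility enters twice: it
    puts the identity into the moment space, and it makes the dual functional coercive. *)

Notation rtr M := (complex.Re (\tr M)).

(** * Real parts, adjoints, Frobenius norm and quadratic forms *)

Section ComplexMatrices.
Variable R : realType.
Local Notation C := R[i].
Implicit Types (a b : R) (x y z : C).

Lemma ReD x y : complex.Re (x + y) = complex.Re x + complex.Re y.
Proof. by case: x y => [a b] [c d]. Qed.

Lemma ReN x : complex.Re (- x) = - complex.Re x.
Proof. by case: x. Qed.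

Lemma ReB x y : complex.Re (x - y) = complex.Re x - complex.Re y.
Proof. by rewrite ReD ReN. Qed.

Lemma ReZ a x : complex.Re (toC a * x) = a * complex.Re x.
Proof. by case: x => [b c] /=; rewrite mul0r subr0. Qed.

Lemma Re_sum (I : Type) (r : seq I) (P : pred I) (F : I -> C) :
  complex.Re (\sum_(i <- r | P i) F i) = \sum_(i <- r | P i) complex.Re (F i).
Proof. by elim/big_rec2: _ => //= i y1 y2 _ <-; rewrite ReD. Qed.

Lemma Re_conjc x : complex.Re (Num.conj x) = complex.Re x.
Proof. by case: x. Qed.

Lemma Im_conjc x : complex.Im (Num.conj x) = - complex.Im x.
Proof. by case: x. Qed.

Lemma toCD a b : toC (a + b) = toC a + toC b.
Proof. exact: (rmorphD (real_complex R)). Qed.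

Lemma toCM a b : toC (a * b) = toC a * toC b.
Proof. exact: (rmorphM (real_complex R)). Qed.

Lemma toCV a : toC a^-1 = (toC a)^-1.
Proof. exact: (fmorphV (real_complex R)). Qed.

Lemma toC_conj a : Num.conj (toC a) = toC a.
Proof. by apply/eqP; rewrite eq_complex /= oppr0 !eqxx. Qed.

Lemma normsqC x : x * Num.conj x = toC (complex.Re x ^+ 2 + complex.Im x ^+ 2).
Proof. by rewrite -normCK -add_Re2_Im2. Qed.

Lemma Re_le_norm x : toC `|complex.Re x| <= `|x|.
Proof.
rewrite normc_def lecR -sqrtr_sqr ler_wsqrtr// lerDl; exact: sqr_ge0.
Qed.

Lemma Im_le_norm x : toC `|complex.Im x| <= `|x|.
Proof.
rewrite normc_def lecR -sqrtr_sqr ler_wsqrtr// lerDr; exact: sqr_ge0.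
Qed.

Lemma norm_le_ReIm x : `|x| <= toC (`|complex.Re x| + `|complex.Im x|).
Proof.
rewrite normc_def lecR -(ler_sqr (sqrtr_ge0 _)) ?nnegrE ?addr_ge0//.
rewrite sqr_sqrtr ?addr_ge0 ?sqr_ge0//.
rewrite -[X in X + _ <= _]real_normK ?num_real// -[X in _ + X <= _]real_normK ?num_real//.
have := normr_ge0 (complex.Re x); have := normr_ge0 (complex.Im x).
set u := `|_|; set v := `|_|; move=> *; nra.
Qed.

Lemma norm_toC a : `|toC a| = toC `|a|.
Proof. by rewrite normc_def /= expr0n addr0 sqrtr_sqr. Qed.

Section Adjoint.
Variables p q r : nat.
Implicit Types (A : 'M[C]_(p, q)) (B : 'M[C]_(q, r)).

Lemma ctrE A i j : ctr A i j = Num.conj (A j i).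
Proof. by rewrite !mxE. Qed.

Lemma ctrM A B : ctr (A *m B) = ctr B *m ctr A.
Proof. by rewrite /ctr trmx_mul map_mxM. Qed.

Lemma ctrD A A' : ctr (A + A') = ctr A + ctr A'.
Proof. by rewrite /ctr linearD map_mxD. Qed.

Lemma ctrZ a A : ctr (toC a *: A) = toC a *: ctr A.
Proof. by apply/matrixP => i j; rewrite ctrE !mxE rmorphM; congr (_ * _); exact: toC_conj. Qed.

Lemma ctr_sum (I : Type) (s : seq I) (P : pred I) (F : I -> 'M[C]_(p, q)) :
  ctr (\sum_(i <- s | P i) F i) = \sum_(i <- s | P i) ctr (F i).
Proof.
elim/big_rec2: _ => [|i y1 y2 _ <-]; last by rewrite ctrD.
by rewrite /ctr trmx0 map_mx0.
Qed.

End Adjoint.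

Lemma ctrK p q (A : 'M[C]_(p, q)) : ctr (ctr A) = A.
Proof. by apply/matrixP => i j; rewrite !ctrE conjCK. Qed.

Lemma ctr1 k : ctr (1%:M : 'M[C]_k) = 1%:M.
Proof. by rewrite /ctr trmx1 map_mx1. Qed.

Lemma rtrD k (A B : 'M[C]_k) : rtr (A + B) = rtr A + rtr B.
Proof. by rewrite linearD ReD. Qed.

Lemma rtrB k (A B : 'M[C]_k) : rtr (A - B) = rtr A - rtr B.
Proof. by rewrite linearB ReB. Qed.

Lemma rtrZ k a (A : 'M[C]_k) : rtr (toC a *: A) = a * rtr A.
Proof. by rewrite linearZ ReZ. Qed.

Lemma rtr_sum k (I : Type) (s : seq I) (P : pred I) (F : I -> 'M[C]_k) :
  rtr (\sum_(i <- s | P i) F i) = \sum_(i <- s | P i) rtr (F i).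
Proof.
by elim/big_rec2: _ => [|i y1 y2 _ <-]; rewrite ?rtrD// mxtrace0.
Qed.

Lemma rtrC p q (A : 'M[C]_(p, q)) (B : 'M[C]_(q, p)) :
  rtr (A *m B) = rtr (B *m A).
Proof. by rewrite mxtrace_mulC. Qed.

Lemma rtr_mulE p q (A : 'M[C]_(p, q)) (B : 'M[C]_(q, p)) :
  rtr (A *m B) = \sum_i \sum_j complex.Re (A i j * B j i).
Proof.
rewrite /mxtrace Re_sum; apply: eq_bigr => i _.
by rewrite mxE Re_sum.
Qed.

(** The squared Frobenius norm, on columns the squared Euclidean length. Without the square root it
    is polynomial in real and imaginary parts, hence easy to integrate. *)
Definition frob p q (A : 'M[C]_(p, q)) : R :=
  \sum_i \sum_j (complex.Re (A i j) ^+ 2 + complex.Im (A i j) ^+ 2).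

Lemma frobE p q (A : 'M[C]_(p, q)) : frob A = rtr (A *m ctr A).
Proof.
rewrite rtr_mulE; apply: eq_bigr => i _; apply: eq_bigr => j _.
by rewrite ctrE normsqC.
Qed.

Lemma frob_ge0 p q (A : 'M[C]_(p, q)) : 0 <= frob A.
Proof. by do 2![apply: sumr_ge0 => ? _]; rewrite addr_ge0 ?sqr_ge0. Qed.

Lemma frob_eq0 p q (A : 'M[C]_(p, q)) : frob A <= 0 -> A = 0.
Proof.
move=> A0; have /eqP := le_anti (introT andP (conj A0 (frob_ge0 A))).
rewrite /frob psumr_eq0; last first.
  by move=> i _; apply: sumr_ge0 => j _; rewrite addr_ge0 ?sqr_ge0.
move=> /allP h; apply/matrixP => i j.
have := h i; rewrite mem_index_enum psumr_eq0 /=; last first.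
  by move=> k _; rewrite addr_ge0 ?sqr_ge0.
move=> /(_ isT)/allP/(_ j); rewrite mem_index_enum => /(_ isT) /=.
rewrite paddr_eq0 ?sqr_ge0// !sqrf_eq0 mxE => /andP[/eqP h1 /eqP h2].
by apply/eqP; rewrite eq_complex h1 h2 !eqxx.
Qed.

(** Taking the real part moves all order arguments from the partial order of [C] to [R]; for
    Hermitian [M] nothing is lost, by [quad_qf]. *)
Definition qf k (M : 'M[C]_k) (u : 'cV[C]_k) : R :=
  complex.Re ((ctr u *m M *m u) 0 0).

Lemma qfE k (M : 'M[C]_k) u : qf M u = rtr (M *m (u *m ctr u)).
Proof. by rewrite mulmxA rtrC mulmxA /mxtrace big_ord1. Qed.

Lemma qfD k (M M' : 'M[C]_k) u : qf (M + M') u = qf M u + qf M' u.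
Proof. by rewrite !qfE mulmxDl rtrD. Qed.

Lemma qfZ k a (M : 'M[C]_k) u : qf (toC a *: M) u = a * qf M u.
Proof. by rewrite !qfE -scalemxAl rtrZ. Qed.

Lemma qfB k (M M' : 'M[C]_k) u : qf (M - M') u = qf M u - qf M' u.
Proof. by rewrite !qfE mulmxBl rtrB. Qed.

Lemma qf_scalar k a (u : 'cV[C]_k) : qf (toC a)%:M u = a * frob u.
Proof. by rewrite qfE mul_scalar_mx rtrZ frobE. Qed.

Lemma qf_congr k l (M : 'M[C]_k) (X : 'M[C]_(k, l)) u :
  qf (ctr X *m M *m X) u = qf M (X *m u).
Proof. by rewrite /qf ctrM !mulmxA. Qed.

Lemma frob_gt0 k (u : 'cV[C]_k) : u != 0 -> 0 < frob u.
Proof.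
by move=> u0; rewrite ltNge; apply: contraNN u0 => /frob_eq0 ->.
Qed.

Lemma quad_qf k (M : 'M[C]_k) u : Defs.hermitian M ->
  (ctr u *m M *m u) 0 0 = toC (qf M u).
Proof.
move=> hM; set z := (_ *m _) 0 0.
have : Num.conj z = z.
  by rewrite /z -[in LHS](ctrE (ctr u *m M *m u)) !ctrM ctrK hM mulmxA.
move=> /(congr1 (@complex.Im R)); rewrite Im_conjc => h0.
have h : complex.Im z = 0 by lra.
by apply/eqP; rewrite eq_complex /qf -/z h /= !eqxx.
Qed.

Lemma cpd_qf k (M : 'M[C]_k) : cpd M -> forall u, u != 0 -> 0 < qf M u.
Proof. by move=> pM u /pM; rewrite ltcE => /andP[]. Qed.

Lemma cpsd_qf k (M : 'M[C]_k) : cpsd M -> forall u, 0 <= qf M u.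
Proof. by move=> pM u; have := pM u; rewrite lecE => /andP[]. Qed.

Lemma qf_cpd k (M : 'M[C]_k) : Defs.hermitian M ->
  (forall u, u != 0 -> 0 < qf M u) -> cpd M.
Proof. by move=> hM h u /h; rewrite quad_qf// ltcR. Qed.

Lemma qf_cpsd k (M : 'M[C]_k) : Defs.hermitian M ->
  (forall u, 0 <= qf M u) -> cpsd M.
Proof. by move=> hM h u; rewrite quad_qf// lecR. Qed.

Lemma hermitianD k (M M' : 'M[C]_k) : Defs.hermitian M -> Defs.hermitian M' -> Defs.hermitian (M + M').
Proof. by rewrite /Defs.hermitian ctrD => -> ->. Qed.

Lemma hermitianZ k a (M : 'M[C]_k) : Defs.hermitian M -> Defs.hermitian (toC a *: M).
Proof. by move=> h; rewrite /Defs.hermitian ctrZ h. Qed.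

Lemma hermitian_congr k l (M : 'M[C]_k) (X : 'M[C]_(k, l)) :
  Defs.hermitian M -> Defs.hermitian (ctr X *m M *m X).
Proof. by rewrite /Defs.hermitian !ctrM ctrK => ->; rewrite mulmxA. Qed.

Lemma hermitian_scalar k a : Defs.hermitian ((toC a)%:M : 'M[C]_k).
Proof. by rewrite -scalemx1; apply: hermitianZ; exact: ctr1. Qed.

Lemma hermitian_sum k (I : Type) (s : seq I) (P : pred I) (F : I -> 'M[C]_k) :
  (forall i, Defs.hermitian (F i)) -> Defs.hermitian (\sum_(i <- s | P i) F i).
Proof. by move=> h; rewrite /Defs.hermitian ctr_sum; apply: eq_bigr => i _; exact: h. Qed.

End ComplexMatrices.


(** * Functional calculus of Hermitian matrices *)

Section Spectral.
Variable R : realType.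
Local Notation C := R[i].
Variable k : nat.
Implicit Types (M Q U V : 'M[C]_k) (e f : 'I_k -> R).

Definition unitary U := ctr U *m U = 1%:M /\ U *m ctr U = 1%:M.

(** Eigenvectors are the columns of [ctr U]. With [U] fixed, changing [e] pointwise is the
    functional calculus: powers and inverses act on [e] alone. *)
Definition spec U e : 'M[C]_k := ctr U *m diag_mx (\row_i toC (e i)) *m U.

Lemma hermitian_specP M : Defs.hermitian M ->
  exists U e, unitary U /\ M = spec U e.
Proof.
move=> hM.
have hs : M \is hermsymmx.
  apply/is_hermitianmxP; rewrite expr0 scale1r.
  exact: esym hM.
have /orthomx_spectralP ME := hermitian_normalmx hs.
have /mxOverP dr := hermitian_spectral_diag_real hs.
have Uu := spectral_unitarymx M.
have iU : invmx (spectralmx M) = ctr (spectralmx M) by rewrite invmx_unitary.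
exists (spectralmx M), (fun i => complex.Re (spectral_diag M 0 i)); split.
  by split; rewrite -iU ?mulmxV ?mulVmx ?spectral_unit.
rewrite /spec -iU {1}ME; congr (_ *m diag_mx _ *m _).
by apply/rowP => i; rewrite !mxE; apply/esym/RRe_real/dr.
Qed.

Lemma specM U e f : unitary U -> spec U e *m spec U f = spec U (fun i => e i * f i).
Proof.
move=> [_ uU]; rewrite /spec !mulmxA -(mulmxA _ U) uU mulmx1.
rewrite -(mulmxA (ctr U)) mulmx_diag; congr (_ *m diag_mx _ *m _).
by apply/rowP => i; rewrite !mxE toCM.
Qed.

Lemma spec1 U : unitary U -> spec U (fun=> 1) = 1%:M.
Proof.
move=> [uU _]; rewrite /spec (_ : \row_i _ = const_mx 1).
  by rewrite diag_const_mx mulmx1.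
by apply/rowP => i; rewrite !mxE.
Qed.

Lemma eq_spec U e f : e =1 f -> spec U e = spec U f.
Proof.
move=> ef; congr (_ *m diag_mx _ *m _).
by apply/rowP => i; rewrite !mxE ef.
Qed.

Lemma mxpow_spec U e N : unitary U -> mxpow (spec U e) N = spec U (fun i => e i ^+ N).
Proof.
move=> uU; elim: N => [|N IH].
  by rewrite /= -(spec1 uU); apply: eq_spec => i; rewrite expr0.
rewrite /mxpow iterS -/(mxpow _ _) IH specM//.
by apply: eq_spec => i; rewrite exprS.
Qed.

Lemma spec_inv U e : unitary U -> (forall i, e i != 0) ->
  spec U e *m spec U (fun i => (e i)^-1) = 1%:M.
Proof.
move=> uU e0; rewrite specM// -(spec1 uU).
by apply: eq_spec => i; rewrite mulfV.
Qed.

Lemma invmx_spec U e : unitary U -> (forall i, e i != 0) ->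
  invmx (spec U e) = spec U (fun i => (e i)^-1).
Proof.
move=> uU e0; have h := spec_inv uU e0.
by rewrite -[RHS](mulKmx (mulmx1_unit h).1) h mulmx1.
Qed.

Lemma hermitian_spec U e : Defs.hermitian (spec U e).
Proof.
rewrite /Defs.hermitian /spec !ctrM ctrK mulmxA; congr (_ *m _ *m _).
apply/matrixP => a b; rewrite ctrE !mxE eq_sym; case: eqVneq => [->|_].
  by rewrite !mulr1n toC_conj.
by rewrite !mulr0n rmorph0.
Qed.

Lemma rtr_spec_mul U e Q :
  rtr (spec U e *m Q) = \sum_i e i * qf Q (col i (ctr U)).
Proof.
rewrite /spec -!mulmxA rtrC -!mulmxA mulmxA /mxtrace Re_sum.
apply: eq_bigr => i _; rewrite -!mulmxA mul_diag_mx !mxE ReZ; congr (_ * _).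
transitivity (complex.Re ((U *m (Q *m ctr U)) i i)); first by rewrite mxE.
rewrite /qf !mulmxA.
rewrite (_ : ctr (col i (ctr U)) = row i U); last first.
  by apply/rowP => j; rewrite ctrE !mxE conjCK.
by rewrite -row_mul colE !mulmxA -colE -row_mul !mxE.
Qed.

Lemma qf_spec_col U e i : unitary U -> qf (spec U e) (col i (ctr U)) = e i.
Proof.
move=> [_ uU]; rewrite /qf /spec.
have h : U *m col i (ctr U) = delta_mx i 0 by rewrite !colE mulmxA uU mul1mx.
rewrite -!mulmxA h !mulmxA.
rewrite -[ctr _ *m ctr U](ctrK) ctrM !ctrK h -[_ *m delta_mx i 0]colE.
rewrite (_ : ctr (delta_mx i 0) = delta_mx 0 i); last first.
  by apply/matrixP => a b; rewrite ctrE !mxE andbC; case: (_ && _); rewrite ?rmorph1 ?rmorph0.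
by rewrite -rowE !mxE eqxx mulr1n.
Qed.

Lemma frob_col_unitary U i : unitary U -> frob (col i (ctr U)) = 1.
Proof.
move=> uU; rewrite frobE -[X in rtr X]mul1mx -qfE -(spec1 uU).
exact: qf_spec_col.
Qed.

Lemma col_unitary_neq0 U i : unitary U -> col i (ctr U) != 0.
Proof.
move=> uU; apply/eqP => h; have := frob_col_unitary i uU.
rewrite h frobE mul0mx mxtrace0 /= => /eqP; rewrite eq_sym; exact/negP/oner_neq0.
Qed.

Lemma spec_ge U e (b : R) : unitary U ->
  (forall u, b * frob u <= qf (spec U e) u) -> forall i, b <= e i.
Proof.
move=> uU h i; have := h (col i (ctr U)).
by rewrite qf_spec_col// frob_col_unitary// mulr1.
Qed.

Lemma spec_gt0 U e : unitary U ->
  (forall u, u != 0 -> 0 < qf (spec U e) u) -> forall i, 0 < e i.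
Proof.
move=> uU h i; rewrite -(qf_spec_col e i uU); apply: h.
exact: col_unitary_neq0.
Qed.

(** Only [M] is diagonalized: the trace is the sum of its eigenvalues times values of the quadratic
    form of [Q]. *)
Lemma rtr_psd_mul M Q : Defs.hermitian M -> (forall u, 0 <= qf M u) ->
  (forall u, 0 <= qf Q u) -> 0 <= rtr (M *m Q).
Proof.
move=> /hermitian_specP[U [e [uU ->]]] pM pQ.
rewrite rtr_spec_mul sumr_ge0// => i _; rewrite mulr_ge0//.
by apply: (spec_ge uU) => u; rewrite mul0r.
Qed.

(** The squared modulus of the inner product of the [i]-th eigenvector of [U] and the [j]-th of [V],
    written as the form of a rank-one spectral projector. *)
Definition overlap U V i j : R := qf (spec V (fun l => (l == j)%:R)) (col i (ctr U)).

Lemma spec_sum V f : spec V f = \sum_j toC (f j) *: spec V (fun l => (l == j)%:R).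
Proof.
rewrite /spec.
transitivity (ctr V *m (\sum_j toC (f j) *: diag_mx (\row_l toC (l == j)%:R)) *m V).
  congr (_ *m _ *m _); apply/matrixP => a b; rewrite summxE !mxE.
  case: (eqVneq a b) => [->|ab]; last first.
    by rewrite mulr0n big1// => j _; rewrite !mxE (negbTE ab) mulr0n mulr0.
  rewrite mulr1n (bigD1 b)//= !mxE !eqxx mulr1n.
  rewrite big1 => [|j jb]; first by rewrite addr0 (_ : toC true%:R = 1) ?mulr1.
  by rewrite !mxE !eqxx eq_sym (negbTE jb) mulr1n (_ : toC false%:R = 0) ?mulr0.
rewrite mulmx_sumr mulmx_suml; apply: eq_bigr => j _.
by rewrite -scalemxAr -scalemxAl.
Qed.

(** The passage from non-commuting matrices to scalars: the weights depend on the two eigenbases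
    only, not on [e] and [f]. *)
Lemma rtr_spec_spec U V e f :
  rtr (spec U e *m spec V f) = \sum_i \sum_j overlap U V i j * (e i * f j).
Proof.
rewrite rtr_spec_mul; apply: eq_bigr => i _.
rewrite (spec_sum V f) qfE mulmx_suml rtr_sum mulr_sumr; apply: eq_bigr => j _.
by rewrite -scalemxAl rtrZ -qfE /overlap [RHS]mulrC mulrA.
Qed.

Lemma overlap_ge0 U V i j : unitary V -> 0 <= overlap U V i j.
Proof.
move=> uV; rewrite /overlap; set e := fun l => _.
have ee : spec V e = ctr (spec V e) *m 1%:M *m spec V e.
  rewrite mulmx1 hermitian_spec specM//.
  by apply: eq_spec => l; rewrite /e -natrM mulnb andbb.
by rewrite ee qf_congr qfE mul1mx -frobE frob_ge0.
Qed.

End Spectral.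


(** * Klein's inequality for negative powers, with quadratic bounds *)

Section Klein.
Variable R : realType.
Local Notation C := R[i].

Implicit Types (a b c d x y : R).

(** The first-order Taylor remainder of [t^(N+1)] at [y]; its nonnegativity is a form of Bernoulli's
    inequality. *)
Definition bernoulli N (x y : R) : R :=
  x ^+ N.+1 - y ^+ N.+1 - N.+1%:R * y ^+ N * (x - y).

(** Each step of the recursion adds an explicit square, so lower and upper bounds both follow by
    induction. *)
Lemma bernoulliS N x y :
  bernoulli N.+1 x y = x * bernoulli N x y + N.+1%:R * y ^+ N * (x - y) ^+ 2.
Proof.
rewrite /bernoulli !exprS -[N.+2%:R]natr1.
set X := x ^+ N; set Y := y ^+ N; set n := N.+1%:R; ring.
Qed.

Lemma bernoulli_ge0 N x y : 0 <= x -> 0 <= y -> 0 <= bernoulli N x y.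
Proof.
move=> x0 y0; elim: N => [|N IH].
  by rewrite /bernoulli !expr1 expr0 mulr1 mul1r subrr.
have h : 0 <= y ^+ N := exprn_ge0 N y0.
rewrite bernoulliS addr_ge0 ?(mulr_ge0 x0)//.
by apply: mulr_ge0; [exact: mulr_ge0|exact: sqr_ge0].
Qed.

Lemma bernoulli_le N (b : R) : 0 <= b -> exists2 c : R, 0 <= c &
  forall x y, 0 <= x <= b -> 0 <= y <= b -> bernoulli N x y <= c * (x - y) ^+ 2.
Proof.
move=> b0; elim: N => [|N [c c0 IH]].
  exists 0 => // x y _ _.
  by rewrite /bernoulli !expr1 expr0 mulr1 mul1r subrr mul0r.
exists (b * c + N.+1%:R * b ^+ N) => [|x y hx hy].
  by rewrite addr_ge0 ?mulr_ge0 ?exprn_ge0.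
have /andP[x0 xb] := hx; have /andP[y0 yb] := hy.
rewrite bernoulliS mulrDl lerD//.
  rewrite -mulrA ler_pM ?bernoulli_ge0//; exact: IH.
rewrite ler_wpM2r ?sqr_ge0// ler_wpM2l//.
by rewrite lerXn2r ?nnegrE.
Qed.

(* The second-order remainder of [t |-> t ^- N.+1]; substituting [x = 1/b],
   [y = 1/a] makes it a Bernoulli remainder plus an explicit square. *)
Definition phi N (a b : R) : R :=
  (b ^+ N.+1)^-1 - (a ^+ N.+1)^-1 + N.+1%:R * (a ^+ N.+2)^-1 * (b - a).

Lemma phiE N a b : 0 < a -> 0 < b ->
  phi N a b = bernoulli N b^-1 a^-1 +
              N.+1%:R * a^-1 ^+ N.+2 * b^-1 * (b - a) ^+ 2.
Proof.
move=> a0 b0; rewrite /phi /bernoulli -!exprVn !exprS.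
set X := _ ^+ N; set Y := _ ^+ N; set n := N.+1%:R.
field; by rewrite !gt_eqF.
Qed.

(** The Bernoulli part is dropped; the explicit square alone gives strong convexity, and its
    coefficient is smallest when both points equal the upper bound [c]. *)
Lemma phi_ge N (c a b : R) : 0 < a <= c -> 0 < b <= c ->
  N.+1%:R * c^-1 ^+ N.+3 * (b - a) ^+ 2 <= phi N a b.
Proof.
move=> /andP[a0 ac] /andP[b0 bc].
have c0 : 0 < c by exact: lt_le_trans ac.
have [a1 b1 c1] : [/\ 0 <= a^-1, 0 <= b^-1 & 0 <= c^-1].
  by rewrite !invr_ge0 (ltW a0) (ltW b0) (ltW c0).
rewrite phiE// -[leLHS]add0r lerD ?bernoulli_ge0//.
apply: ler_wpM2r; first exact: sqr_ge0.
rewrite -mulrA; apply: ler_wpM2l => //.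
rewrite exprSr; apply: ler_pM; rewrite ?exprn_ge0//.
  by rewrite lerXn2r ?nnegrE// lef_pV2 ?posrE.
by rewrite lef_pV2 ?posrE.
Qed.

(** Inverses lie in [[0, 1/d]], where the Bernoulli remainder is quadratic in
    [b^-1 - a^-1 = (a - b)/(a b)]; the division by [a b] produces the factor [d^-4]. *)
Lemma phi_le N (d : R) : 0 < d -> exists2 c : R, 0 <= c &
  forall a b, d <= a -> d <= b -> phi N a b <= c * (b - a) ^+ 2.
Proof.
move=> d0; have d1 : 0 <= d^-1 by rewrite invr_ge0 ltW.
have [c c0 hc] := bernoulli_le N d1.
exists (c * d^-1 ^+ 4 + N.+1%:R * d^-1 ^+ N.+3).
  by rewrite addr_ge0// mulr_ge0// exprn_ge0.
move=> a b da db.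
have a0 : 0 < a by exact: lt_le_trans da.
have b0 : 0 < b by exact: lt_le_trans db.
have ia : 0 <= a^-1 <= d^-1 by rewrite invr_ge0 (ltW _)//= lef_pV2 ?posrE.
have ib : 0 <= b^-1 <= d^-1 by rewrite invr_ge0 (ltW _)//= lef_pV2 ?posrE.
have /andP[ia0 iad] := ia; have /andP[ib0 ibd] := ib.
rewrite phiE// mulrDl lerD//.
  apply: (le_trans (hc _ _ ib ia)).
  have -> : (b^-1 - a^-1) ^+ 2 = (a^-1 ^+ 2 * b^-1 ^+ 2) * (b - a) ^+ 2.
    by field; rewrite !gt_eqF.
  rewrite -[leRHS]mulrA; apply: ler_wpM2l => //; apply: ler_wpM2r; first exact: sqr_ge0.
  rewrite (exprD _ 2 2); apply: ler_pM; rewrite ?exprn_ge0//.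
    by rewrite lerXn2r ?nnegrE.
  by rewrite lerXn2r ?nnegrE.
apply: ler_wpM2r; first exact: sqr_ge0.
rewrite -mulrA; apply: ler_wpM2l => //.
rewrite [leRHS]exprSr; apply: ler_pM; rewrite ?exprn_ge0//.
by rewrite lerXn2r ?nnegrE.
Qed.

Variable k : nat.
Implicit Types (M : 'M[C]_k).

(** The first-order Taylor remainder at [M] of [M |-> tr M^-(N+1)], whose derivative in direction
    [X] is [-(N+1) tr (M^-(N+2) X)]. With [nu = N+2] the exponent is [nu - 1]. *)
Definition klein N M M' : R :=
  rtr (invmx (mxpow M' N.+1)) - rtr (invmx (mxpow M N.+1)) +
  N.+1%:R * rtr (invmx (mxpow M N.+2) *m (M' - M)).

Lemma klein_phi N (U V : 'M[C]_k) e f : unitary U -> unitary V ->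
  (forall i, 0 < e i) -> (forall i, 0 < f i) ->
  klein N (spec U e) (spec V f) =
    \sum_i \sum_j overlap U V i j * phi N (e i) (f j).
Proof.
move=> uU uV e0 f0; rewrite /klein !mxpow_spec//.
have en n i : e i ^+ n != 0 by rewrite expf_neq0 ?gt_eqF.
have fn n i : f i ^+ n != 0 by rewrite expf_neq0 ?gt_eqF.
rewrite !invmx_spec// mulmxBr rtrB specM//.
(* A trace involving one matrix only is multiplied by the identity, written as [spec _ (fun=> 1)] in
   the other eigenbasis, so that all four traces carry the same weights. *)
rewrite -[X in rtr X - _ + _]mul1mx -(spec1 uU).
rewrite -[X in _ - rtr X + _]mulmx1 -[X in _ * (_ - rtr X)]mulmx1 -(spec1 uV).
rewrite [X in X - _ + _]rtr_spec_spec.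
rewrite [X in _ - X + _]rtr_spec_spec.
rewrite [X in _ + _ * (X - _)]rtr_spec_spec.
rewrite [X in _ + _ * (_ - X)]rtr_spec_spec.
rewrite -2!sumrB mulr_sumr -big_split.
apply: eq_bigr => i _; rewrite -!sumrB mulr_sumr -big_split /=.
by apply: eq_bigr => j _; rewrite /phi; ring.
Qed.

(** The same weights as in [klein_phi], so scalar comparisons of [phi] with a square can be summed
    term by term. *)
Lemma frobB_spec (U V : 'M[C]_k) e f : unitary U -> unitary V ->
  frob (spec V f - spec U e) =
    \sum_i \sum_j overlap U V i j * (f j - e i) ^+ 2.
Proof.
move=> uU uV.
(* The scalar [-1] is presented as [toC (-1)] to bring it under the rules for real scaling. *)
rewrite frobE ctrD -scaleN1r -[-1](_ : toC (-1) = -1); last first.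
  by apply/eqP; rewrite eq_complex /= oppr0 !eqxx.
rewrite ctrZ 2!hermitian_spec.
rewrite mulmxDl 2!mulmxDr -2!scalemxAl -2!scalemxAr 3!rtrD.
rewrite 4!rtrZ.
rewrite [X in _ + _ * X + _]rtrC.
rewrite !specM// -[spec V (fun i => _)]mul1mx -(spec1 uU).
rewrite -[X in _ + (_ + (-1) * ((-1) * rtr X))]mulmx1 -(spec1 uV).
rewrite [X in X + _ + _]rtr_spec_spec.
rewrite [X in _ + _ * X + _]rtr_spec_spec.
rewrite [X in _ + _ + (_ * X + _)]rtr_spec_spec.
rewrite [X in _ + _ + (_ + _ * (_ * X))]rtr_spec_spec.
rewrite !mulr_sumr -!big_split.
apply: eq_bigr => i _; rewrite !mulr_sumr -!big_split /=.
by apply: eq_bigr => j _; ring.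
Qed.

Lemma klein_ge N (c : R) M M' : Defs.hermitian M -> Defs.hermitian M' ->
  (forall u, u != 0 -> 0 < qf M u <= c * frob u) ->
  (forall u, u != 0 -> 0 < qf M' u <= c * frob u) ->
  N.+1%:R * c^-1 ^+ N.+3 * frob (M' - M) <= klein N M M'.
Proof.
move=> /hermitian_specP[U [e [uU ->]]] /hermitian_specP[V [f [uV ->]]] hM hM'.
have he i : 0 < e i <= c.
  have := hM _ (col_unitary_neq0 i uU).
  by rewrite qf_spec_col// frob_col_unitary// mulr1.
have hf i : 0 < f i <= c.
  have := hM' _ (col_unitary_neq0 i uV).
  by rewrite qf_spec_col// frob_col_unitary// mulr1.
rewrite klein_phi// => [|i|i]; [|by case/andP: (he i)|by case/andP: (hf i)].
rewrite frobB_spec// mulr_sumr; apply: ler_sum => i _.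
rewrite mulr_sumr; apply: ler_sum => j _.
rewrite mulrCA; apply: ler_wpM2l; first exact: overlap_ge0.
exact: phi_ge.
Qed.

Lemma klein_le N (d : R) : 0 < d -> exists2 c : R, 0 <= c &
  forall M M', Defs.hermitian M -> Defs.hermitian M' ->
    (forall u, d * frob u <= qf M u) -> (forall u, d * frob u <= qf M' u) ->
    klein N M M' <= c * frob (M' - M).
Proof.
move=> d0; have [c c0 hc] := phi_le N d0; exists c => // M M'.
move=> /hermitian_specP[U [e [uU ->]]] /hermitian_specP[V [f [uV ->]]] hM hM'.
have he := spec_ge uU hM; have hf := spec_ge uV hM'.
rewrite klein_phi// => [|i|i]; [|exact: lt_le_trans (he i)|exact: lt_le_trans (hf i)].
rewrite frobB_spec// mulr_sumr; apply: ler_sum => i _.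
rewrite mulr_sumr; apply: ler_sum => j _.
rewrite mulrCA; apply: ler_wpM2l; first exact: overlap_ge0.
exact: hc.
Qed.

Lemma klein_ge0 N M M' : Defs.hermitian M -> Defs.hermitian M' ->
  (forall u, u != 0 -> 0 < qf M u) -> (forall u, u != 0 -> 0 < qf M' u) ->
  0 <= klein N M M'.
Proof.
move=> /hermitian_specP[U [e [uU ->]]] /hermitian_specP[V [f [uV ->]]] hM hM'.
have he := spec_gt0 uU hM; have hf := spec_gt0 uV hM'.
rewrite klein_phi//; apply: sumr_ge0 => i _; apply: sumr_ge0 => j _.
apply: mulr_ge0; first exact: overlap_ge0.
have e1 : 0 <= (e i)^-1 by rewrite invr_ge0 ltW.
have f1 : 0 <= (f j)^-1 by rewrite invr_ge0 ltW.
rewrite phiE// addr_ge0 ?bernoulli_ge0//.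
apply: mulr_ge0; last exact: sqr_ge0.
by apply: mulr_ge0 => //; apply: mulr_ge0 => //; exact: exprn_ge0.
Qed.

(* The smallest eigenvalue is at most [qf M u] for a unit vector [u]. *)
Lemma rtr_inv_pow_ge N M u : Defs.hermitian M ->
  (forall v, v != 0 -> 0 < qf M v) -> frob u = 1 ->
  (qf M u)^-1 - 1 <= rtr (invmx (mxpow M N.+1)).
Proof.
move=> /hermitian_specP[U [e [uU ->]]] hM u1; have he := spec_gt0 uU hM.
set q := qf _ u.
have u0 : u != 0.
  apply/eqP => h; move: u1; rewrite h frobE mul0mx mxtrace0 => /eqP.
  by rewrite eq_sym oner_eq0.
have q0 : 0 < q by exact: hM.
have [i ei] : exists i, e i <= q.
  (* [q] is an average of the eigenvalues with nonnegative weights of sum 1; if all eigenvalues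
     exceeded [q], every weight would vanish. *)
  apply/existsP; rewrite -[X in is_true X]negbK negb_exists; apply/negP => /forallP h.
  have w0 i : 0 <= qf (u *m ctr u) (col i (ctr U)).
    have -> : u *m ctr u = ctr (ctr u) *m 1%:M *m ctr u by rewrite ctrK mulmx1.
    by rewrite qf_congr qfE mul1mx -frobE frob_ge0.
  have qE : q = \sum_i e i * qf (u *m ctr u) (col i (ctr U)).
    by rewrite -rtr_spec_mul -qfE.
  have wE : \sum_i qf (u *m ctr u) (col i (ctr U)) = 1.
    rewrite -[RHS]u1 frobE -[in RHS](mul1mx (u *m ctr u)) -(spec1 uU) rtr_spec_mul.
    by apply: eq_bigr => i _; rewrite mul1r.
  have : \sum_i (e i - q) * qf (u *m ctr u) (col i (ctr U)) = 0.
    under eq_bigr do rewrite mulrBl.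
    by rewrite sumrB -qE -mulr_sumr wE mulr1 subrr.
  move=> /eqP; rewrite psumr_eq0 => [/allP h'|i _]; last first.
    by rewrite mulr_ge0// subr_ge0 ltW// ltNge h.
  move/eqP: wE; rewrite big1 ?(eq_sym 0) ?oner_eq0// => i _.
  have := h' i; rewrite mem_index_enum => /(_ isT).
  by rewrite mulf_eq0 subr_eq0 gt_eqF ?ltNge ?h//= => /eqP.
rewrite mxpow_spec// invmx_spec// => [|j]; last by rewrite expf_neq0 ?gt_eqF.
rewrite -[X in rtr X]mulmx1 rtr_spec_mul (bigD1 i)//=.
have one j : qf 1%:M (col j (ctr U)) = 1 by rewrite -(spec1 uU) qf_spec_col.
rewrite one mulr1 -[leLHS]addr0 lerD//; last first.
  by apply: sumr_ge0 => j _; rewrite one mulr1 invr_ge0 exprn_ge0// ltW.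
have y0 : 0 < (e i)^-1 by rewrite invr_gt0.
have -> : (e i ^+ N.+1)^-1 = (e i)^-1 ^+ N.+1 by rewrite exprVn.
have qy : q^-1 <= (e i)^-1 by rewrite lef_pV2 ?posrE.
(* An inverse eigenvalue at least 1 is dominated by its powers. Otherwise the left side is negative,
   which is what the [- 1] in the statement pays for. *)
have [y1|y1] := leP 1 (e i)^-1.
  apply: le_trans (_ : (e i)^-1 <= _); first lra.
  by rewrite -[leLHS]expr1 ler_weXn2l.
by apply: le_trans (_ : 0 <= _); [lra|rewrite exprn_ge0 ?ltW].
Qed.

End Klein.

(** * Parametrization of the circle and integration over it *)

Section Circle.
Variable R : realType.
Local Notation C := R[i].
Implicit Types (s t : R) (f g : C -> R).

Lemma expi_onT t : onT (expi t).
Proof. by rewrite /onT normc_def /= cos2Dsin2 sqrtr1. Qed.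

Lemma onT_expi (z : C) : onT z -> exists2 t, - pi <= t <= pi & z = expi t.
Proof.
case: z => a b; rewrite /onT normc_def /= => -[h].
have ab : a ^+ 2 + b ^+ 2 = 1.
  by rewrite -(@sqr_sqrtr _ (a ^+ 2 + b ^+ 2)) ?h ?expr1n// addr_ge0 ?sqr_ge0.
have b2 := sqr_ge0 b.
have a1 : -1 <= a <= 1 by apply/andP; split; nra.
have sE : sin (acos a) = `|b|.
  by rewrite sin_acos// (_ : 1 - a ^+ 2 = b ^+ 2) ?sqrtr_sqr//; lra.
have ac : cos (acos a) = a by apply: acosK; rewrite in_itv.
have := acos_ge0 a1; have := acos_lepi a1 => u1 u0.
have [b0|b0] := leP 0 b.
  exists (acos a); last by rewrite /expi ac sE ger0_norm.
  by rewrite u1 andbT; have := pi_ge0 R; lra.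
exists (- acos a); last by rewrite /expi cosN sinN ac sE ltr0_norm// opprK.
by rewrite lerN2 u1 /=; have := pi_ge0 R; lra.
Qed.

Lemma lipschitz_of_derive (f df : R -> R) :
  (forall x : R, is_derive x 1 f (df x)) -> (forall x : R, `|df x| <= 1) ->
  forall s t, `|f s - f t| <= `|s - t|.
Proof.
move=> fd df1.
suff H s t : t <= s -> `|f s - f t| <= `|s - t|.
  move=> s t; have [/H//|/ltW/H] := leP t s.
  by rewrite (distrC (f t)) (distrC t).
move=> ts; have [|c _ ->] := MVT_segment ts (fun x _ => fd x).
  apply: continuous_subspaceT => x; apply: differentiable_continuous.
  by apply/derivable1_diffP.
by rewrite normrM ler_piMl.
Qed.

Lemma expi_lipschitz s t : `|expi s - expi t| <= toC (2 * `|s - t|).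
Proof.
apply: le_trans (norm_le_ReIm _) _; rewrite lecR /= (mulr_natl _ 2) mulr2n lerD//.
  by apply: (@lipschitz_of_derive _ (fun x => - sin x)) => x; rewrite normrN sin_max.
by apply: (@lipschitz_of_derive _ cos) => x; exact: cos_max.
Qed.

(** Measurable along the angle and bounded on the circle: a class closed under ring operations in
    which integrability is automatic. It contains the integrands that occur below. *)
Definition bmR (f : C -> R) :=
  measurable_fun setT (f \o @expi R) /\
  exists K : R, forall z, onT z -> `|f z| <= K.

Lemma bmR_cst (a : R) : bmR (fun=> a).
Proof. by split; [exact: measurable_cst|exists `|a|]. Qed.

Lemma bmRD f g : bmR f -> bmR g -> bmR (fun z => f z + g z).
Proof.
move=> [mf [K hK]] [mg [L hL]]; split; first exact: measurable_funD.
by exists (K + L) => z hz; rewrite (le_trans (ler_normD _ _))// lerD ?hK ?hL.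
Qed.

Lemma bmRM f g : bmR f -> bmR g -> bmR (fun z => f z * g z).
Proof.
move=> [mf [K hK]] [mg [L hL]]; split; first exact: measurable_funM.
by exists (K * L) => z hz; rewrite normrM ler_pM ?hK ?hL.
Qed.

Lemma bmRN f : bmR f -> bmR (fun z => - f z).
Proof.
move=> [mf [K hK]]; split; first exact: measurableT_comp.
by exists K => z hz; rewrite normrN hK.
Qed.

Lemma bmRB f g : bmR f -> bmR g -> bmR (fun z => f z - g z).
Proof. by move=> bf bg; apply: bmRD => //; exact: bmRN. Qed.

Lemma bmRZ (a : R) f : bmR f -> bmR (fun z => a * f z).
Proof. by move=> bf; apply: bmRM => //; exact: bmR_cst. Qed.

Lemma bmR_sum (I : Type) (r : seq I) (P : pred I) (F : I -> C -> R) :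
  (forall i, bmR (F i)) -> bmR (fun z => \sum_(i <- r | P i) F i z).
Proof.
move=> bF; elim: r => [|i r IH].
  by under eq_fun do rewrite big_nil; exact: bmR_cst.
under eq_fun do rewrite big_cons; case: (P i) => //; exact: bmRD.
Qed.

Local Notation mu := (@lebesgue_measure R).
Local Notation I := (`[(- pi : R), pi]%classic).

Lemma lebesgue_measure_circle : mu I = (2 * pi)%:E.
Proof.
transitivity (lebesgue_measure [set` `[(- pi : R), pi]]) => //.
rewrite lebesgue_measure_itv /= lte_fin ifT -?EFinB; last first.
  by have := pi_gt0 R; lra.
by congr (_%:E); lra.
Qed.

Lemma integrable_bmR f : bmR f -> mu.-integrable I (EFin \o (f \o @expi R)).
Proof.
move=> [mf [K hK]]; apply: measurable_bounded_integrable => //.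
- by rewrite [X in (X < _)%E]lebesgue_measure_circle ltry.
- exact: measurable_funTS.
- exists K; split; first exact: num_real.
  by move=> M KM t _ /=; rewrite (le_trans (hK _ (expi_onT t)))// ltW.
Qed.

Lemma circ_intRD f g : bmR f -> bmR g ->
  circ_intR (fun z => f z + g z) = circ_intR f + circ_intR g.
Proof.
move=> bf bg; rewrite /circ_intR -mulrDr; congr (_ * _).
by rewrite -RintegralD//; exact: integrable_bmR.
Qed.

Lemma circ_intRB f g : bmR f -> bmR g ->
  circ_intR (fun z => f z - g z) = circ_intR f - circ_intR g.
Proof.
move=> bf bg; rewrite /circ_intR -mulrBr; congr (_ * _).
by rewrite -RintegralB//; exact: integrable_bmR.
Qed.

Lemma circ_intRZ (a : R) f : bmR f ->
  circ_intR (fun z => a * f z) = a * circ_intR f.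
Proof.
move=> bf; rewrite /circ_intR mulrCA; congr (_ * _).
by rewrite -RintegralZl//; exact: integrable_bmR.
Qed.

Lemma circ_intR_cst (a : R) : circ_intR (fun=> a) = a.
Proof.
rewrite /circ_intR [X in _ * X](_ : _ = a * (2 * pi)).
  by rewrite mulrCA mulVf ?mulr1// mulf_neq0// gt_eqF// pi_gt0.
rewrite -[LHS]/(Rintegral mu I (fun=> a)) Rintegral_cst//; congr (_ * _).
by rewrite [X in fine X]lebesgue_measure_circle.
Qed.

Lemma circ_intR_sum (J : Type) (r : seq J) (P : pred J) (F : J -> C -> R) :
  (forall i, bmR (F i)) ->
  circ_intR (fun z => \sum_(i <- r | P i) F i z) =
  \sum_(i <- r | P i) circ_intR (F i).
Proof.
move=> bF; elim: r => [|i r IH].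
  by under eq_fun do rewrite big_nil; rewrite circ_intR_cst big_nil.
under eq_fun do rewrite big_cons; rewrite big_cons; case: (P i) => //.
by rewrite circ_intRD ?IH//; exact: bmR_sum.
Qed.

Lemma le_circ_intR f g : bmR f -> bmR g -> (forall z, onT z -> f z <= g z) ->
  circ_intR f <= circ_intR g.
Proof.
move=> bf bg fg; rewrite /circ_intR ler_wpM2l ?invr_ge0 ?mulr_ge0 ?pi_ge0//.
apply: le_Rintegral => //; rewrite ?integrable_bmR//; try exact: integrable_bmR.
by move=> t _; exact/fg/expi_onT.
Qed.

Lemma eq_circ_intR f g : (forall z, onT z -> f z = g z) ->
  circ_intR f = circ_intR g.
Proof.
move=> fg; rewrite /circ_intR; congr (_ * _); apply: eq_Rintegral => t _.
exact/fg/expi_onT.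
Qed.

Lemma circ_intR_ge0 f : bmR f -> (forall z, onT z -> 0 <= f z) -> 0 <= circ_intR f.
Proof.
move=> bf f0; rewrite -(circ_intR_cst 0); apply: le_circ_intR => //.
exact: bmR_cst.
Qed.

Lemma circ_intR_le f (a : R) : bmR f -> (forall z, onT z -> f z <= a) ->
  circ_intR f <= a.
Proof.
move=> bf fa; rewrite -[leRHS]circ_intR_cst; apply: le_circ_intR => //.
exact: bmR_cst.
Qed.

Definition bmC (f : C -> C) :=
  bmR (fun z => complex.Re (f z)) /\ bmR (fun z => complex.Im (f z)).

Lemma bmCD (f g : C -> C) : bmC f -> bmC g -> bmC (fun z => f z + g z).
Proof.
move=> [f1 f2] [g1 g2]; split.
  rewrite (_ : (fun z => _) = fun z => complex.Re (f z) + complex.Re (g z)).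
    exact: bmRD.
  by apply/funext => z; rewrite ReD.
rewrite (_ : (fun z => _) = fun z => complex.Im (f z) + complex.Im (g z)).
  exact: bmRD.
by apply/funext => z; case: (f z) (g z) => [? ?] [? ?].
Qed.

Lemma bmCM (f g : C -> C) : bmC f -> bmC g -> bmC (fun z => f z * g z).
Proof.
move=> [f1 f2] [g1 g2]; split.
  rewrite (_ : (fun z => _) = fun z => complex.Re (f z) * complex.Re (g z)
                                      - complex.Im (f z) * complex.Im (g z)).
    by apply: bmRB; exact: bmRM.
  by apply/funext => z; case: (f z) (g z) => [? ?] [? ?].
rewrite (_ : (fun z => _) = fun z => complex.Re (f z) * complex.Im (g z)
                                      + complex.Im (f z) * complex.Re (g z)).
  by apply: bmRD; exact: bmRM.
by apply/funext => z; case: (f z) (g z) => [? ?] [? ?].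
Qed.

Lemma bmC_cst (a : C) : bmC (fun=> a).
Proof. by split; exact: bmR_cst. Qed.

Lemma bmC_conj (f : C -> C) : bmC f -> bmC (fun z => Num.conj (f z)).
Proof.
move=> [f1 f2]; split.
  by under eq_fun do rewrite Re_conjc.
by under eq_fun do rewrite Im_conjc; exact: bmRN.
Qed.

Lemma bmC_sum (J : Type) (r : seq J) (P : pred J) (F : J -> C -> C) :
  (forall i, bmC (F i)) -> bmC (fun z => \sum_(i <- r | P i) F i z).
Proof.
move=> bF; elim: r => [|i r IH].
  by under eq_fun do rewrite big_nil; exact: bmC_cst.
under eq_fun do rewrite big_cons; case: (P i) => //; exact: bmCD.
Qed.

Definition bmM p q (F : C -> 'M[C]_(p, q)) := forall i j, bmC (fun z => F z i j).

Lemma bmM_mul p q r (F : C -> 'M[C]_(p, q)) (G : C -> 'M[C]_(q, r)) :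
  bmM F -> bmM G -> bmM (fun z => F z *m G z).
Proof.
move=> bF bG i j; under eq_fun do rewrite mxE.
by apply: bmC_sum => l; apply: bmCM.
Qed.

Lemma bmM_add p q (F G : C -> 'M[C]_(p, q)) :
  bmM F -> bmM G -> bmM (fun z => F z + G z).
Proof. by move=> bF bG i j; under eq_fun do rewrite mxE; exact: bmCD. Qed.

Lemma bmM_cst p q (A : 'M[C]_(p, q)) : bmM (fun=> A).
Proof. by move=> i j; exact: bmC_cst. Qed.

Lemma bmM_scale p q (a : C) (F : C -> 'M[C]_(p, q)) :
  bmM F -> bmM (fun z => a *: F z).
Proof.
move=> bF i j; under eq_fun do rewrite mxE.
by apply: bmCM => //; exact: bmC_cst.
Qed.

Lemma bmM_ctr p q (F : C -> 'M[C]_(p, q)) : bmM F -> bmM (fun z => ctr (F z)).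
Proof. by move=> bF i j; under eq_fun do rewrite ctrE; exact: bmC_conj. Qed.

Lemma bmM_sum p q (J : Type) (r : seq J) (P : pred J) (F : J -> C -> 'M[C]_(p, q)) :
  (forall i, bmM (F i)) -> bmM (fun z => \sum_(i <- r | P i) F i z).
Proof.
move=> bF i j; under eq_fun do rewrite summxE.
by apply: bmC_sum => l; exact: bF.
Qed.

Lemma bmR_rtr k (F : C -> 'M[C]_k) : bmM F -> bmR (fun z => rtr (F z)).
Proof.
move=> bF; rewrite /mxtrace; under eq_fun do rewrite Re_sum.
by apply: bmR_sum => i; case: (bF i i).
Qed.

Lemma bmR_frob k (F : C -> 'M[C]_k) : bmM F -> bmR (fun z => frob (F z)).
Proof.
move=> bF; apply: bmR_sum => i; apply: bmR_sum => j.
by have [b1 b2] := bF i j; apply: bmRD; exact: bmRM.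
Qed.

Lemma rtr_circ_intmx p q (L : 'M[C]_(p, q)) (F : C -> 'M[C]_(q, p)) : bmM F ->
  rtr (L *m circ_intmx F) = circ_intR (fun z => rtr (L *m F z)).
Proof.
move=> bF; rewrite rtr_mulE; under [in RHS]eq_fun do rewrite rtr_mulE.
have b i j : bmC (fun z => L i j * F z j i).
  by apply: bmCM => //; exact: bmC_cst.
rewrite circ_intR_sum => [|i]; last by apply: bmR_sum => j; case: (b i j).
apply: eq_bigr => i _; rewrite circ_intR_sum => [|j]; last by case: (b i j).
apply: eq_bigr => j _; rewrite mxE /circ_int.
have [b1 b2] := bF j i.
case: (L i j) => x y /=.
rewrite -!circ_intRZ// -circ_intRB; [|exact: bmRZ|exact: bmRZ].
by apply: eq_circ_intR => z _; case: (F z j i).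
Qed.

Lemma bounded_bmM p q (F : C -> 'M[C]_(p, q)) : bmM F ->
  exists2 K : R, 0 <= K & forall z, onT z -> forall i j,
    `|complex.Re (F z i j)| <= K /\ `|complex.Im (F z i j)| <= K.
Proof.
move=> bF.
have [K hK] : exists K : 'I_p -> 'I_q -> R, forall i j z, onT z ->
    `|complex.Re (F z i j)| <= K i j /\ `|complex.Im (F z i j)| <= K i j.
  suff /choice[K hK] : forall i, exists K : 'I_q -> R, forall j z, onT z ->
    `|complex.Re (F z i j)| <= K j /\ `|complex.Im (F z i j)| <= K j by exists K.
  move=> i; suff /choice[K hK] : forall j, exists K : R, forall z, onT z ->
    `|complex.Re (F z i j)| <= K /\ `|complex.Im (F z i j)| <= K by exists K.
  move=> j; have [[_ [K hK]] [_ [L hL]]] := bF i j.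
  by exists (Num.max K L) => z hz; rewrite !le_max hK// hL// orbT.
exists (\sum_i \sum_j `|K i j|) => [|z hz i j].
  by do 2![apply: sumr_ge0 => ? _].
have KE : K i j <= \sum_i \sum_j `|K i j|.
  rewrite (bigD1 i)//= (bigD1 j)//= -addrA (le_trans (ler_norm _))// lerDl.
  by rewrite addr_ge0// sumr_ge0// => ? _; rewrite sumr_ge0.
by have [h1 h2] := hK i j z hz; split; exact: le_trans KE.
Qed.

End Circle.

(** * Bounded Lipschitz functions on the circle *)

Section LipschitzOnCircle.
Variable R : realType.
Local Notation C := R[i].
Local Open Scope classical_set_scope.
Implicit Types (f g : C -> C).

(** Boundedness is part of the definition so that products stay in the class; one constant serves
    both bounds. *)
Definition lipT f := exists K : R,
  (forall z, onT z -> `|f z| <= toC K) /\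
  (forall z w, onT z -> onT w -> `|f z - f w| <= toC K * `|z - w|).

Lemma onT1 : onT (1 : C).
Proof. by rewrite /onT normr1. Qed.

Lemma lipT_bound_ge0 (K : R) f : (forall z, onT z -> `|f z| <= toC K) -> 0 <= K.
Proof.
by move=> /(_ _ onT1) h; rewrite -lecR; apply: le_trans h; exact: normr_ge0.
Qed.

Lemma lipT_cst (a : C) : lipT (fun=> a).
Proof.
exists (complex.Re `|a|); split=> [z _|z w _ _].
  by rewrite normc_def.
by rewrite subrr normr0 mulr_ge0// normc_def lecR sqrtr_ge0.
Qed.

Lemma lipT_id : lipT id.
Proof. by exists 1; split=> [z ->|z w _ _]; rewrite -[toC 1]/(1 : C) ?mul1r. Qed.

Lemma lipTD f g : lipT f -> lipT g -> lipT (fun z => f z + g z).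
Proof.
move=> [K [K1 K2]] [L [L1 L2]]; exists (K + L); split=> [z hz|z w hz hw].
  by rewrite toCD (le_trans (ler_normD _ _))// lerD ?K1 ?L1.
rewrite opprD addrACA toCD mulrDl (le_trans (ler_normD _ _))//.
by rewrite lerD ?K2 ?L2.
Qed.

Lemma lipTM f g : lipT f -> lipT g -> lipT (fun z => f z * g z).
Proof.
move=> [K [K1 K2]] [L [L1 L2]]; exists (K * L + K * L).
have K0 := lipT_bound_ge0 K1; have L0 := lipT_bound_ge0 L1.
have KL0 : 0 <= toC (K * L) by rewrite lecR mulr_ge0.
split=> [z hz|z w hz hw].
  rewrite toCD -[leLHS]addr0 lerD// normrM toCM ler_pM ?K1 ?L1//.
have -> : f z * g z - f w * g w = f z * (g z - g w) + (f z - f w) * g w by ring.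
rewrite toCD [in leRHS]mulrDl (le_trans (ler_normD _ _))// !normrM toCM lerD//.
  by rewrite -mulrA ler_pM ?K1 ?L2.
by rewrite mulrAC ler_pM ?K2 ?L1.
Qed.

Lemma lipT_conj f : lipT f -> lipT (fun z => Num.conj (f z)).
Proof.
move=> [K [K1 K2]]; exists K; split=> [z hz|z w hz hw].
  by rewrite norm_conjC K1.
by rewrite -rmorphB norm_conjC K2.
Qed.

Lemma lipT_sum (J : Type) (r : seq J) (P : pred J) (F : J -> C -> C) :
  (forall i, lipT (F i)) -> lipT (fun z => \sum_(i <- r | P i) F i z).
Proof.
move=> bF; elim: r => [|i r IH].
  by under eq_fun do rewrite big_nil; exact: lipT_cst.
under eq_fun do rewrite big_cons; case: (P i) => //; exact: lipTD.
Qed.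

Lemma lipT_prod (J : Type) (r : seq J) (P : pred J) (F : J -> C -> C) :
  (forall i, lipT (F i)) -> lipT (fun z => \prod_(i <- r | P i) F i z).
Proof.
move=> bF; elim: r => [|i r IH].
  by under eq_fun do rewrite big_nil; exact: lipT_cst.
under eq_fun do rewrite big_cons; case: (P i) => //; exact: lipTM.
Qed.

Lemma lipT_horner (p : {poly C}) : lipT (horner p).
Proof.
have -> : horner p = fun z => \sum_(i < size p) p`_i * z ^+ i.
  by apply/funext => z; rewrite horner_coef.
apply: lipT_sum => i; apply: lipTM; first exact: lipT_cst.
elim: (i : nat) => [|n IH].
  by under eq_fun do rewrite expr0; exact: lipT_cst.
by under eq_fun do rewrite exprS; apply: lipTM => //; exact: lipT_id.
Qed.

Lemma lipT_expi f : lipT f -> exists2 K : R, 0 <= K & forall s t,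
  `|f (expi s) - f (expi t)| <= toC (K * `|s - t|).
Proof.
move=> [K [K1 K2]]; have K0 := lipT_bound_ge0 K1.
exists (K * 2) => [|s t]; first by rewrite mulr_ge0.
rewrite (le_trans (K2 _ _ (expi_onT s) (expi_onT t)))// -mulrA toCM.
by apply: ler_wpM2l; [rewrite lecR|exact: expi_lipschitz].
Qed.

Lemma lipschitz_continuous (V : pseudoMetricNormedZmodType R) (K : R) (h : V -> R) :
  (forall s t, `|h s - h t| <= K * `|s - t|) -> continuous h.
Proof.
move=> hK x; apply/cvgrPdist_le => /= e e0.
have K0 : 0 < `|K| + 1 by rewrite ltr_pwDr.
near=> y.
apply: le_trans (hK _ _) _; apply: (@le_trans _ _ ((`|K| + 1) * `|x - y|)).
  by rewrite ler_wpM2r// (le_trans (ler_norm _))// lerDl.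
rewrite mulrC -ler_pdivlMr//; near: y.
by apply: cvgr_dist_le; rewrite ?divr_gt0.
Unshelve. all: by end_near.
Qed.

Lemma lipT_continuous f : lipT f ->
  continuous (fun t => complex.Re (f (expi t))) /\
  continuous (fun t => complex.Im (f (expi t))).
Proof.
move=> /lipT_expi[K K0 hK]; split; apply: (@lipschitz_continuous _ K) => s t.
  rewrite -lecR; apply: le_trans (hK s t).
  by rewrite -ReB; exact: Re_le_norm.
rewrite -lecR; apply: le_trans (hK s t).
have -> : complex.Im (f (expi s)) - complex.Im (f (expi t)) =
          complex.Im (f (expi s) - f (expi t)).
  by case: (f (expi s)) (f (expi t)) => [? ?] [? ?].
exact: Im_le_norm.
Qed.

Lemma lipT_bmC f : lipT f -> bmC f.
Proof.
move=> hf; have [c1 c2] := lipT_continuous hf; have [K [K1 _]] := hf.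
split; split; try exact: continuous_measurable_fun; exists K => z /K1 h;
  rewrite -lecR; apply: le_trans h; [exact: Re_le_norm|exact: Im_le_norm].
Qed.

(** By compactness of [[-pi, pi]], [|f|^2] attains a positive minimum, so [1/f] is bounded, and the
    difference of inverses is controlled by that of [f]. *)
Lemma lipT_inv f : lipT f -> (forall z, onT z -> f z != 0) ->
  lipT (fun z => (f z)^-1).
Proof.
move=> hf f0; have [c1 c2] := lipT_continuous hf.
pose g t : R := complex.Re (f (expi t)) ^+ 2 + complex.Im (f (expi t)) ^+ 2.
have gE t : toC (g t) = `|f (expi t)| ^+ 2 by rewrite -add_Re2_Im2.
have cg : {within `[(- pi : R), pi], continuous g}.
  apply: continuous_subspaceT => t.
  by apply: cvgD; apply: cvgM; [exact: c1|exact: c1|exact: c2|exact: c2].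
have pp : - pi <= pi :> R by have := pi_ge0 R; lra.
have [t0 _ ht0] := EVT_min pp cg.
have g0 : 0 < g t0.
  rewrite -ltcR -[X in _ < X]/(toC (g t0)) gE exprn_gt0// normr_gt0.
  exact/f0/expi_onT.
set c := Num.sqrt (g t0); have cp : 0 < c by rewrite sqrtr_gt0.
have tc0 : 0 < toC c by rewrite ltcR.
have fc z : onT z -> toC c <= `|f z|.
  move=> /onT_expi[t tI ->].
  rewrite -(@ler_pXn2r _ 2) ?nnegrE ?normr_ge0 ?(ltW tc0)//.
  by rewrite -gE expr2 -toCM -expr2 lecR sqr_sqrtr ?(ltW g0)// ht0// in_itv.
have ic z : onT z -> `|(f z)^-1| <= toC c^-1.
  by move=> hz; rewrite normfV toCV lef_pV2 ?posrE ?normr_gt0 ?f0 ?fc.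
have [K [K1 K2]] := hf; have K0 := lipT_bound_ge0 K1.
have ci : 0 <= c^-1 by rewrite invr_ge0 ltW.
exists (c^-1 + c^-1 * c^-1 * K); split=> [z hz|z w hz hw].
  rewrite (le_trans (ic _ hz))// lecR lerDl.
  by rewrite !mulr_ge0.
have -> : (f z)^-1 - (f w)^-1 = (f z)^-1 * (f w)^-1 * (f w - f z).
  by field; rewrite !f0.
rewrite !normrM toCD mulrDl -[leLHS]add0r lerD//.
  by rewrite mulr_ge0// lecR.
rewrite [in leRHS]toCM -[leRHS]mulrA ler_pM ?mulr_ge0//.
  by rewrite toCM ler_pM ?ic.
by rewrite distrC K2.
Qed.

Definition lipM p q (F : C -> 'M[C]_(p, q)) := forall i j, lipT (fun z => F z i j).

Lemma lipM_mul p q r (F : C -> 'M[C]_(p, q)) (G : C -> 'M[C]_(q, r)) :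
  lipM F -> lipM G -> lipM (fun z => F z *m G z).
Proof.
move=> bF bG i j; under eq_fun do rewrite mxE.
by apply: lipT_sum => l; apply: lipTM.
Qed.

Lemma lipM_add p q (F G : C -> 'M[C]_(p, q)) :
  lipM F -> lipM G -> lipM (fun z => F z + G z).
Proof. by move=> bF bG i j; under eq_fun do rewrite mxE; exact: lipTD. Qed.

Lemma lipM_cst p q (A : 'M[C]_(p, q)) : lipM (fun=> A).
Proof. by move=> i j; exact: lipT_cst. Qed.

Lemma lipM_scale p q (a : C) (F : C -> 'M[C]_(p, q)) :
  lipM F -> lipM (fun z => a *: F z).
Proof.
move=> bF i j; under eq_fun do rewrite mxE.
by apply: lipTM => //; exact: lipT_cst.
Qed.

Lemma lipM_ctr p q (F : C -> 'M[C]_(p, q)) : lipM F -> lipM (fun z => ctr (F z)).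
Proof. by move=> bF i j; under eq_fun do rewrite ctrE; exact: lipT_conj. Qed.

Lemma lipM_bmM p q (F : C -> 'M[C]_(p, q)) : lipM F -> bmM F.
Proof. by move=> lF i j; exact: lipT_bmC. Qed.

Lemma lipM_mxpow k (F : C -> 'M[C]_k) N : lipM F -> lipM (fun z => mxpow (F z) N).
Proof.
move=> lF; elim: N => [|N IH]; first exact: lipM_cst.
by rewrite -[lipM _]/(lipM (fun z => F z *m mxpow (F z) N)); exact: lipM_mul.
Qed.

Lemma lipT_det k (F : C -> 'M[C]_k) : lipM F -> lipT (fun z => \det (F z)).
Proof.
move=> lF; apply: lipT_sum => s; apply: lipTM; first exact: lipT_cst.
by apply: lipT_prod => i; exact: lF.
Qed.

(** Cramer's rule: the entries of the inverse are polynomials in the entries of [F] divided by a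
    determinant without zeros on the circle. *)
Lemma lipM_inv k (F : C -> 'M[C]_k) : lipM F ->
  (forall z, onT z -> F z \in unitmx) -> lipM (fun z => invmx (F z)).
Proof.
move=> lF uF i j.
suff [K [K1 K2]] : lipT (fun z => (\det (F z))^-1 * (\adj (F z)) i j).
  have E z : onT z -> invmx (F z) i j = (\det (F z))^-1 * (\adj (F z)) i j.
    by move=> hz; rewrite /invmx uF// mxE.
  exists K; split=> [z hz|z w hz hw]; first by rewrite E// K1.
  by rewrite !E// K2.
apply: lipTM.
  apply: lipT_inv; first exact: lipT_det.
  by move=> z /uF; rewrite unitmxE unitfE.
under eq_fun do rewrite mxE /cofactor.
apply: lipTM; first exact: lipT_cst.
apply: lipT_det => a b; under eq_fun do rewrite !mxE; exact: lF.
Qed.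

End LipschitzOnCircle.

(** * Young's inequality for traces and its consequences *)

Section MoreMatrices.
Variable R : realType.
Local Notation C := R[i].

(** Young's inequality, entry by entry, by completing a square. The free parameter [t] replaces
    Cauchy-Schwarz and its square roots. *)
Lemma rtr_mul_le p q (t : R) (A : 'M[C]_(p, q)) (B : 'M[C]_(q, p)) : 0 < t ->
  2 * rtr (A *m B) <= t * frob A + t^-1 * frob B.
Proof.
move=> t0; rewrite rtr_mulE /frob [in X in _ + _ * X]exchange_big /= !mulr_sumr -big_split.
apply: ler_sum => i _; rewrite !mulr_sumr -big_split; apply: ler_sum => j _ /=.
case: (A i j) (B j i) => [a b] [c d] /=.
rewrite -subr_ge0.
have -> : t * (a ^+ 2 + b ^+ 2) + t^-1 * (c ^+ 2 + d ^+ 2) - 2 * (a * c - b * d) =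
   t^-1 * ((t * a - c) ^+ 2 + (t * b + d) ^+ 2) by field; rewrite gt_eqF.
by apply: mulr_ge0; [rewrite invr_ge0 ltW|rewrite addr_ge0 ?sqr_ge0].
Qed.

Lemma frobN p q (A : 'M[C]_(p, q)) : frob (- A) = frob A.
Proof.
apply: eq_bigr => i _; apply: eq_bigr => j _; rewrite mxE.
by case: (A i j) => a b /=; rewrite !sqrrN.
Qed.

Lemma frobZ p q (a : R) (A : 'M[C]_(p, q)) : frob (toC a *: A) = a ^+ 2 * frob A.
Proof.
rewrite mulr_sumr; apply: eq_bigr => i _; rewrite mulr_sumr; apply: eq_bigr => j _.
by rewrite mxE; case: (A i j) => b c /=; ring.
Qed.

Lemma rtr_mul_ge p q (t : R) (A : 'M[C]_(p, q)) (B : 'M[C]_(q, p)) : 0 < t ->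
  - (t * frob A + t^-1 * frob B) <= 2 * rtr (A *m B).
Proof.
move=> t0; have := rtr_mul_le (- A) B t0; rewrite frobN mulNmx.
rewrite linearN ReN; lra.
Qed.

Lemma frob_outer k (u : 'cV[C]_k) : frob (u *m ctr u) = frob u ^+ 2.
Proof.
have -> : frob u = \sum_i (complex.Re (u i 0) ^+ 2 + complex.Im (u i 0) ^+ 2).
  by apply: eq_bigr => i _; rewrite big_ord1.
rewrite expr2 mulr_suml; apply: eq_bigr => i _.
rewrite mulr_sumr; apply: eq_bigr => j _.
rewrite mxE big_ord1 ctrE; case: (u i 0) (u j 0) => [a b] [c d] /=; ring.
Qed.

Lemma frob0 p q : frob (0 : 'M[C]_(p, q)) = 0.
Proof. by rewrite frobE mul0mx mxtrace0. Qed.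

Lemma qf_0 k (A : 'M[C]_k) : qf A 0 = 0.
Proof. by rewrite qfE mul0mx mulmx0 mxtrace0. Qed.

Lemma qf_le_frob k (A : 'M[C]_k) u : `|qf A u| <= (frob A + 1) * frob u.
Proof.
have [->|u0] := eqVneq u 0; first by rewrite qf_0 frob0 normr0 mulr0.
have f0 := frob_gt0 u0; have A0 := frob_ge0 A.
have := rtr_mul_le A (u *m ctr u) f0; have := rtr_mul_ge A (u *m ctr u) f0.
rewrite -qfE frob_outer expr2 mulKf ?gt_eqF// ler_norml => h1 h2.
by apply/andP; split; nra.
Qed.

Lemma frob_bound p q (K : R) (A : 'M[C]_(p, q)) :
  (forall i j, `|complex.Re (A i j)| <= K /\ `|complex.Im (A i j)| <= K) ->
  frob A <= (2 * K ^+ 2) *+ (p * q).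
Proof.
move=> hA.
apply: (@le_trans _ _ (\sum_(i < p) \sum_(j < q) (2 * K ^+ 2))); last first.
  by rewrite !sumr_const !card_ord mulnC mulrnA.
apply: ler_sum => i _; apply: ler_sum => j _.
have [h1 h2] := hA i j; rewrite mulr_natl mulr2n.
have sq (x : R) : `|x| <= K -> x ^+ 2 <= K ^+ 2.
  move=> h; rewrite -real_normK ?num_real// lerXn2r// nnegrE//.
  exact: le_trans h.
by rewrite lerD ?sq.
Qed.

End MoreMatrices.

(** * The moment space, its duality and a finite basis *)

Section MomentSpace.
Variable R : realType.
Local Notation C := R[i].
Variables (n m : nat) (G : C -> 'M[C]_(n, m)).
Hypothesis lG : lipM G.

Let bG : bmM G. Proof. exact: lipM_bmM. Qed.

Lemma bmM_sandwich (Phi : C -> 'M[C]_m) : bmM Phi ->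
  bmM (fun z => G z *m Phi z *m ctr (G z)).
Proof. by move=> bP; apply: bmM_mul; [exact: bmM_mul|exact: bmM_ctr]. Qed.

Lemma frob_bmM p q (F : C -> 'M[C]_(p, q)) : bmM F ->
  exists2 K : R, 0 <= K & forall z, onT z -> frob (F z) <= K.
Proof.
move=> /bounded_bmM[K K0 hK]; exists ((2 * K ^+ 2) *+ (p * q)).
  by rewrite mulrn_wge0// mulr_ge0// sqr_ge0.
by move=> z hz; apply: frob_bound => i j; exact: hK.
Qed.

Lemma spec_density_bmM k (Phi : C -> 'M[C]_k) : spec_density Phi ->
  bmM Phi /\ forall z, onT z -> Defs.hermitian (Phi z).
Proof.
move=> [mP [K hK] _ hP]; split=> // i j; have [m1 m2] := mP i j.
split; split=> //; exists K => z hz; rewrite -lecR; apply: le_trans (hK z hz i j).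
  exact: Re_le_norm.
exact: Im_le_norm.
Qed.

Lemma bmM_spec_density k (Phi : C -> 'M[C]_k) (e : R) : bmM Phi -> 0 < e ->
  (forall z, onT z -> Defs.hermitian (Phi z)) ->
  (forall z, onT z -> forall u, e * frob u <= qf (Phi z) u) -> spec_density Phi.
Proof.
move=> bP e0 hP pP; split=> //.
- by move=> i j; have [[m1 _] [m2 _]] := bP i j.
- have [K K0 hK] := bounded_bmM bP; exists (K + K) => z hz i j.
  apply: le_trans (norm_le_ReIm _) _; rewrite lecR.
  by have [h1 h2] := hK z hz i j; rewrite lerD.
- exists e; split=> // z hz; apply: qf_cpsd.
    apply: hermitianD; first exact: hP.
    rewrite -scaleN1r -[-1](_ : toC (-1) = -1).
      by apply: hermitianZ; exact: hermitian_scalar.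
    by apply/eqP; rewrite eq_complex /= oppr0 !eqxx.
  by move=> u; rewrite qfB qf_scalar subr_ge0 pP.
Qed.

(** A bounded measurable Hermitian function is a difference of two densities, obtained by adding and
    subtracting a large multiple of the identity. Coercivity thus disappears from the description of
    the span. *)
Lemma in_QGP (L : 'M[C]_n) : in_QG G L <->
  exists Phi, [/\ bmM Phi, (forall z, onT z -> Defs.hermitian (Phi z)) &
    L = circ_intmx (fun z => G z *m Phi z *m ctr (G z))].
Proof.
split=> [[K [c [Phis [hP ->]]]]|[Phi [bP hP ->]]].
  exists (fun z => \sum_(k < K) toC (c k) *: Phis k z); split=> //.
    apply: bmM_sum => k; apply: bmM_scale.
    by have [] := spec_density_bmM (hP k).
  move=> z hz; apply: hermitian_sum => k; apply: hermitianZ.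
  by have [_ h] := spec_density_bmM (hP k); exact: h.
(* The form of [Phi] is at least [-(K + 1)] times the squared length, so [b = K + 2] leaves
   coercivity constant 1. *)
have [K K0 hK] := frob_bmM bP; pose b := K + 2.
have b0 : 0 < b by rewrite /b; lra.
exists 2, (fun k => if k == ord0 then 1 else - b),
  (fun k => if k == ord0 then (fun z => Phi z + (toC b)%:M) else (fun=> 1%:M)).
split=> [k|].
  case: ifP => _.
    apply: (bmM_spec_density (e := 1)) => //.
    - by apply: bmM_add => //; exact: bmM_cst.
    - by move=> z hz; apply: hermitianD; [exact: hP|exact: hermitian_scalar].
    - move=> z hz u; rewrite qfD qf_scalar mul1r.
      have := qf_le_frob (Phi z) u; rewrite ler_norml => /andP[h _].
      have f0 := frob_ge0 u; have := hK z hz; rewrite /b => h'.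
      have : (frob (Phi z) + 1) * frob u <= (K + 1) * frob u.
        by rewrite ler_wpM2r// lerD2r.
      lra.
  apply: (bmM_spec_density (e := 1)) => //.
  - exact: bmM_cst.
  - by move=> z _; exact: ctr1.
  - move=> z _ u; rewrite -[1%:M]/((toC 1)%:M) qf_scalar//.
congr circ_intmx; apply/funext => z; congr (_ *m _ *m _).
rewrite big_ord_recl big_ord1 /=.
have -> : (toC 1 : C) = 1 by [].
rewrite scale1r scalemx1 -addrA -raddfD -toCD subrr.
by rewrite (_ : toC 0 = 0)// raddf0 addr0.
Qed.

Lemma circ_intmxD p q (F H : C -> 'M[C]_(p, q)) : bmM F -> bmM H ->
  circ_intmx (fun z => F z + H z) = circ_intmx F + circ_intmx H.
Proof.
move=> bF bH; apply/matrixP => i j; rewrite !mxE /circ_int.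
have [f1 f2] := bF i j; have [h1 h2] := bH i j.
apply/eqP; rewrite eq_complex /= -!circ_intRD//.
apply/andP; split; apply/eqP/eq_circ_intR => z _; rewrite mxE ?ReD//.
by case: (F z i j) (H z i j) => [? ?] [? ?].
Qed.

Lemma circ_intmxZ p q (a : R) (F : C -> 'M[C]_(p, q)) : bmM F ->
  circ_intmx (fun z => toC a *: F z) = toC a *: circ_intmx F.
Proof.
move=> bF; apply/matrixP => i j; rewrite !mxE /circ_int.
have [f1 f2] := bF i j.
apply/eqP; rewrite eq_complex /= !mul0r subr0 addr0 -!circ_intRZ//.
apply/andP; split; apply/eqP/eq_circ_intR => z _; rewrite mxE ?ReZ//.
by case: (F z i j) => [x y] /=; rewrite mul0r addr0.
Qed.

Lemma in_QGD L L' : in_QG G L -> in_QG G L' -> in_QG G (L + L').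
Proof.
move=> /in_QGP[P [bP hP ->]] /in_QGP[P' [bP' hP' ->]]; apply/in_QGP.
exists (fun z => P z + P' z); split.
- exact: bmM_add.
- by move=> z hz; apply: hermitianD; [exact: hP|exact: hP'].
rewrite -circ_intmxD; [|exact: bmM_sandwich..].
by congr circ_intmx; apply/funext => z; rewrite mulmxDr mulmxDl.
Qed.

Lemma in_QGZ (a : R) L : in_QG G L -> in_QG G (toC a *: L).
Proof.
move=> /in_QGP[P [bP hP ->]]; apply/in_QGP.
exists (fun z => toC a *: P z); split.
- exact: bmM_scale.
- by move=> z hz; apply: hermitianZ; exact: hP.
rewrite -circ_intmxZ; last exact: bmM_sandwich.
by congr circ_intmx; apply/funext => z; rewrite -scalemxAr -scalemxAl.
Qed.

Lemma in_QG0 : in_QG G 0.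
Proof.
exists 0, (fun=> 0), (fun _ _ => 0); split=> [[]//|].
apply/matrixP => i j; rewrite !mxE /circ_int.
under eq_circ_intR do rewrite big_ord0 mulmx0 mul0mx mxE /=.
under [X in Complex _ X]eq_circ_intR do rewrite big_ord0 mulmx0 mul0mx mxE /=.
by rewrite !circ_intR_cst.
Qed.

Lemma in_QG_sum (K : nat) (x : 'I_K -> R) (E : 'I_K -> 'M[C]_n) :
  (forall k, in_QG G (E k)) -> in_QG G (\sum_k toC (x k) *: E k).
Proof.
move=> hE; elim/big_ind: _ => [||k _]; [exact: in_QG0|exact: in_QGD|].
exact: in_QGZ.
Qed.

Lemma in_QG_hermitian L : in_QG G L -> Defs.hermitian L.
Proof.
move=> /in_QGP[P [bP hP ->]]; apply/matrixP => i j; rewrite ctrE !mxE.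
have b := bmM_sandwich bP.
have hE z : onT z -> (G z *m P z *m ctr (G z)) j i =
    Num.conj ((G z *m P z *m ctr (G z)) i j).
  by move=> hz; rewrite -ctrE !ctrM ctrK hP// mulmxA.
rewrite /circ_int; apply/eqP; rewrite eq_complex /=; apply/andP; split.
  by apply/eqP/eq_circ_intR => z hz; rewrite hE// Re_conjc.
rewrite -mulN1r -circ_intRZ; last by have [] := b j i.
by apply/eqP/eq_circ_intR => z hz; rewrite hE// Im_conjc mulN1r opprK.
Qed.

(** The map [X |-> G^* X G] is the adjoint of the moment map; matrix statements about [X] become
    integral statements on the circle. *)
Lemma rtr_dual (X : 'M[C]_n) (Phi : C -> 'M[C]_m) : bmM Phi ->
  rtr (X *m circ_intmx (fun z => G z *m Phi z *m ctr (G z))) =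
  circ_intR (fun z => rtr (ctr (G z) *m X *m G z *m Phi z)).
Proof.
move=> bP; rewrite rtr_circ_intmx; last exact: bmM_sandwich.
by apply: eq_circ_intR => z _; rewrite !mulmxA [LHS]rtrC !mulmxA.
Qed.

Definition orthonormal K (E : 'I_K -> 'M[C]_n) :=
  (forall k, in_QG G (E k)) /\ forall k l, rtr (E k *m E l) = (k == l)%:R.

(** Listing real and imaginary parts of the entries turns the family into a real matrix [A] with
    [A A^T = 1], whose rank is at most its number of columns. *)
Lemma orthonormal_size K (E : 'I_K -> 'M[C]_n) : orthonormal E ->
  (K <= #|{: 'I_n * 'I_n * bool}|)%N.
Proof.
move=> [hE oE].
pose c (A : 'M[C]_n) (x : 'I_n * 'I_n * bool) : R :=
  if x.2 then complex.Re (A x.1.1 x.1.2) else complex.Im (A x.1.1 x.1.2).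
pose A : 'M[R]_(K, #|{: 'I_n * 'I_n * bool}|) := \matrix_(k, l) c (E k) (enum_val l).
have AA : A *m A^T = 1%:M.
  apply/matrixP => k l; rewrite !mxE -oE -[in RHS](in_QG_hermitian (hE l)) rtr_mulE.
  under eq_bigr do rewrite !mxE.
  rewrite -(big_enum_val (fun x => c (E k) x * c (E l) x)) /=.
  rewrite [in RHS]pair_bigA /= -[in LHS](pair_bigA _ (fun p b => c (E k) (p, b) * c (E l) (p, b))) /=.
  apply: eq_bigr => -[i j] _; rewrite /c /= big_bool /= ctrE.
  by case: (E k i j) (E l i j) => [? ?] [? ?] /=; ring.
have := mxrankM_maxl A A^T; rewrite AA mxrank1 => /leq_trans; apply.
exact: rank_leq_col.
Qed.

(** An orthonormal family of maximal size spans: a nonzero residual of the Fourier expansion would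
    be orthogonal to it and, once normalized, extend it. *)
Lemma QG_basis : exists K (E : 'I_K -> 'M[C]_n),
  (forall k, in_QG G (E k)) /\
  forall L, in_QG G L -> L = \sum_k toC (rtr (L *m E k)) *: E k.
Proof.
pose P K := `[< exists E : 'I_K -> 'M[C]_n, orthonormal E >].
have P0 : exists K, P K.
  by exists 0; apply/asboolP; exists (fun=> 0); split=> -[].
have PM K : P K -> (K <= #|{: 'I_n * 'I_n * bool}|)%N.
  by move=> /asboolP[E]; exact: orthonormal_size.
have [K /asboolP[E [hE oE]] maxK] := ex_maxnP P0 PM.
exists K, E; split=> // L hL; set S := \sum_k _.
pose D := L + toC (-1) *: S.
have DE : D = L - S.
  by rewrite /D (_ : toC (-1) = -1) ?scaleN1r//; apply/eqP; rewrite eq_complex /= oppr0 !eqxx.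
have hD : in_QG G D by apply: in_QGD => //; apply: in_QGZ; exact: in_QG_sum.
have DD l : rtr (D *m E l) = 0.
  rewrite DE mulmxBl rtrB mulmx_suml rtr_sum (bigD1 l)//= -scalemxAl rtrZ oE eqxx mulr1.
  rewrite big1 ?addr0 ?subrr// => k kl.
  by rewrite -scalemxAl rtrZ oE (negbTE kl) mulr0.
have fD : rtr (D *m D) = frob D by rewrite frobE in_QG_hermitian.
apply/eqP; rewrite -subr_eq0 -DE; apply/eqP/frob_eq0; rewrite leNgt; apply/negP => f0.
pose a := (Num.sqrt (frob D))^-1.
have a2 : a * (a * frob D) = 1.
  rewrite /a mulrA -invfM -expr2 sqr_sqrtr ?(ltW f0)// mulVf// gt_eqF//.
(* The normalized residual is appended at the last index. *)
pose E' (i : 'I_K.+1) := if unlift ord_max i is Some j then E j else toC a *: D.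
suff /maxK : P K.+1 by rewrite ltnn.
apply/asboolP; exists E'; split.
  by move=> k; rewrite /E'; case: unliftP => [j _|_] //; exact: in_QGZ.
move=> k l; rewrite /E'; case: (unliftP ord_max k) => [k' ->|->];
  case: (unliftP ord_max l) => [l' ->|->].
- by rewrite oE (inj_eq lift_inj).
- by rewrite -scalemxAr rtrZ rtrC DD mulr0 eq_sym (negbTE (neq_lift _ _)).
- by rewrite -scalemxAl rtrZ DD mulr0 (negbTE (neq_lift _ _)).
- by rewrite -scalemxAr -scalemxAl !rtrZ fD a2 eqxx.
Qed.

End MomentSpace.

(** The arithmetic of an ascent step: at maximality the linear gain [t f] is at most the loss
    [c t^2 B], while the choice of [t] makes that loss less than half the gain. *)
Lemma first_order_contra (R : realFieldType) (B I J J' c f t : R) :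
  J' <= J -> J + t * f - c * (t ^+ 2 * I) <= J' -> I <= B -> 0 <= c -> 0 < t ->
  t * (2 * (c * B + 1)) <= f -> 0 < f -> False.
Proof.
move=> j1 j2 IB c0 t0 tf f0.
have : t * f <= c * (t ^+ 2 * B).
  apply: (@le_trans _ _ (c * (t ^+ 2 * I))); first lra.
  by rewrite ler_wpM2l// ler_wpM2l// sqr_ge0.
have -> : c * (t ^+ 2 * B) = t * (t * (c * B)) by ring.
rewrite ler_pM2l// => j3; nra.
Qed.

(** * Expansion of the dual functional, uniqueness, first-order condition *)

Section DualFunctional.
Variable R : realType.
Local Notation C := R[i].
Variables (n m N : nat) (G : C -> 'M[C]_(n, m)) (W : C -> 'M[C]_m).
Hypotheses (lG : lipM G) (lW : lipM W).
Hypothesis uW : forall z, onT z -> W z \in unitmx.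
Hypothesis QG1 : in_QG G 1%:M.
Local Notation nu := N.+2.
Local Notation Mn := (Mnu nu G W).
Implicit Types (L X : 'M[C]_n).

Definition pull X z : 'M[C]_m := ctr (G z *m W z) *m X *m (G z *m W z).

Lemma MnuE L z : Mn L z = 1%:M + toC nu%:R^-1 *: pull L z.
Proof. by rewrite /Mnu /pull toCV ctrM !mulmxA. Qed.

Lemma pullD X Y z : pull (X + Y) z = pull X z + pull Y z.
Proof. by rewrite /pull mulmxDr mulmxDl. Qed.

Lemma pullZ (a : R) X z : pull (toC a *: X) z = toC a *: pull X z.
Proof. by rewrite /pull -scalemxAr -scalemxAl. Qed.

Lemma lipM_pull X : lipM (pull X).
Proof.
have l : lipM (fun z => G z *m W z) by exact: lipM_mul.
apply: lipM_mul => //; apply: lipM_mul; [exact: lipM_ctr|exact: lipM_cst].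
Qed.

Lemma bmM_pull X : bmM (pull X).
Proof. exact/lipM_bmM/lipM_pull. Qed.

Lemma lipM_Mnu L : lipM (Mn L).
Proof.
have -> : Mn L = fun z => 1%:M + toC nu%:R^-1 *: pull L z.
  by apply/funext => z; rewrite MnuE.
by apply: lipM_add; [exact: lipM_cst|apply: lipM_scale; exact: lipM_pull].
Qed.

Lemma MnuD L X z : Mn (L + X) z = Mn L z + toC nu%:R^-1 *: pull X z.
Proof. by rewrite !MnuE pullD scalerDr addrA. Qed.

Lemma MnuB L L' z : Mn L' z - Mn L z = toC nu%:R^-1 *: pull (L' - L) z.
Proof. by rewrite -{1}(subrKC L L') MnuD addrC addKr. Qed.

Lemma hermitian_pull X z : Defs.hermitian X -> Defs.hermitian (pull X z).
Proof. exact: hermitian_congr. Qed.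

Lemma hermitian_Mnu L z : Defs.hermitian L -> Defs.hermitian (Mn L z).
Proof.
move=> hL; rewrite MnuE; apply: hermitianD; first exact: ctr1.
by apply: hermitianZ; exact: hermitian_pull.
Qed.

Definition posT L := forall z, onT z -> forall u, u != 0 -> 0 < qf (Mn L z) u.

Lemma LplusP L : Lplus nu G W L <-> in_QG G L /\ posT L.
Proof.
split=> -[hL pL]; split=> // z hz; first exact/cpd_qf/pL.
by apply: qf_cpd; [apply: hermitian_Mnu; exact: in_QG_hermitian hL|exact: pL].
Qed.

Lemma unitmx_mxpow k (M : 'M[C]_k) e : Defs.hermitian M ->
  (forall u, u != 0 -> 0 < qf M u) -> mxpow M e \in unitmx.
Proof.
move=> /hermitian_specP[U [d [uU ->]]] /(spec_gt0 uU) d0.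
rewrite mxpow_spec//; have h i : d i ^+ e != 0 by rewrite expf_neq0 ?gt_eqF.
exact: (mulmx1_unit (spec_inv uU h)).1.
Qed.

Section AtPositive.
Variable L : 'M[C]_n.
Hypotheses (hL : in_QG G L) (pL : posT L).

Lemma lipM_inv_pow e : lipM (fun z => invmx (mxpow (Mn L z) e)).
Proof.
apply: lipM_inv; first by apply: lipM_mxpow; exact: lipM_Mnu.
move=> z hz; apply: unitmx_mxpow; last exact: pL.
by apply: hermitian_Mnu; exact: in_QG_hermitian hL.
Qed.

Lemma bmM_Phinu : bmM (Phinu nu G W L).
Proof.
apply: lipM_bmM; apply: lipM_mul; last exact: lipM_ctr.
by apply: lipM_mul => //; exact: lipM_inv_pow.
Qed.

Lemma hermitian_Phinu z : onT z -> Defs.hermitian (Phinu nu G W L z).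
Proof.
move=> hz; rewrite /Phinu -{1}[W z]ctrK; apply: hermitian_congr.
have /hermitian_specP[U [d [uU E]]] := hermitian_Mnu z (in_QG_hermitian lG hL).
have d0 : forall i, 0 < d i by apply: (spec_gt0 uU); rewrite -E; exact: pL.
rewrite E mxpow_spec// invmx_spec//; first exact: hermitian_spec.
by move=> i; rewrite expf_neq0 ?gt_eqF.
Qed.

(** The gradient of the dual functional for the pairing [tr (X Y)]; its vanishing is the moment
    constraint. *)
Definition Dnu := circ_intmx (fun z => G z *m Phinu nu G W L z *m ctr (G z)) - 1%:M.

(** [Phi_nu(L)] is bounded and Hermitian, so its moment is in the space; the identity belongs there
    by [QG1]. The gradient is thereby an admissible direction. *)
Lemma in_QG_Dnu : in_QG G Dnu.
Proof.
rewrite /Dnu -scaleN1r -[-1](_ : toC (-1) = -1).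
  apply: in_QGD => //; last exact: in_QGZ.
  apply/in_QGP => //; exists (Phinu nu G W L); split=> //.
    exact: bmM_Phinu.
  exact: hermitian_Phinu.
by apply/eqP; rewrite eq_complex /= oppr0 !eqxx.
Qed.

End AtPositive.

Lemma bmR_klein L L' : in_QG G L -> in_QG G L' -> posT L -> posT L' ->
  bmR (fun z => klein N (Mn L z) (Mn L' z)).
Proof.
move=> hL hL' pL pL'; apply: bmRD.
  by apply: bmRB; apply: bmR_rtr; apply: lipM_bmM; exact: lipM_inv_pow.
apply: bmRZ; apply: bmR_rtr; apply: lipM_bmM; apply: lipM_mul.
  exact: lipM_inv_pow.
under eq_fun do rewrite MnuB.
by apply: lipM_scale; exact: lipM_pull.
Qed.

Lemma JnuE L : Jnu nu G W L = nu%:R / - N.+1%:R *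
  circ_intR (fun z => rtr (invmx (mxpow (Mn L z) N.+1))) - rtr L.
Proof.
rewrite /Jnu (_ : 1 - nu%:R = - N.+1%:R :> R)//.
by rewrite -[nu]addn1 natrD; ring.
Qed.

(** The prefactor [nu/(1-nu)], the exponent [1-nu] and the slope [1/nu] of [M(L)] cancel in the
    linear term, leaving [tr (M^-nu W^* G^* X G W)]. Duality turns its integral into the moment of
    [Phi_nu(L)] paired with [X]. *)
Lemma Jnu_expand L L' : in_QG G L -> in_QG G L' -> posT L -> posT L' ->
  Jnu nu G W L' = Jnu nu G W L + rtr ((L' - L) *m Dnu L)
    - nu%:R / N.+1%:R * circ_intR (fun z => klein N (Mn L z) (Mn L' z)).
Proof.
move=> hL hL' pL pL'.
have b l : in_QG G l -> posT l -> forall e, bmR (fun z => rtr (invmx (mxpow (Mn l z) e))).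
  by move=> hl pl e; apply: bmR_rtr; apply: lipM_bmM; exact: lipM_inv_pow.
have b2 : bmR (fun z => rtr (invmx (mxpow (Mn L z) N.+2) *m (Mn L' z - Mn L z))).
  apply: bmR_rtr; apply: lipM_bmM; apply: lipM_mul.
    exact: lipM_inv_pow.
  under eq_fun do rewrite MnuB.
  by apply: lipM_scale; exact: lipM_pull.
pose I l := circ_intR (fun z => rtr (invmx (mxpow (Mn l z) N.+1))).
pose w := circ_intR (fun z => rtr (invmx (mxpow (Mn L z) N.+2) *m (Mn L' z - Mn L z))).
have DE : rtr ((L' - L) *m Dnu L) = nu%:R * w - (rtr L' - rtr L).
  rewrite /Dnu mulmxBr mulmx1 rtrB rtrB; congr (_ - _).
  rewrite rtr_dual//; last exact: bmM_Phinu.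
  rewrite /w -circ_intRZ//; apply: eq_circ_intR => z hz.
  rewrite MnuB -scalemxAr rtrZ mulVKf; last by rewrite pnatr_eq0.
  by rewrite /Phinu /pull ctrM !mulmxA [LHS]rtrC !mulmxA [LHS]rtrC !mulmxA.
have KE : circ_intR (fun z => klein N (Mn L z) (Mn L' z)) = I L' - I L + N.+1%:R * w.
  rewrite /klein circ_intRD; [|by apply: bmRB; exact: b|exact: bmRZ].
  rewrite circ_intRB; [|exact: b..].
  by rewrite circ_intRZ.
have JE l : Jnu nu G W l = nu%:R / - N.+1%:R * I l - rtr l by exact: JnuE.
rewrite 2!JE KE DE; clearbody I w.
have n0 : N.+1%:R != 0 :> R by rewrite pnatr_eq0.
by field.
Qed.

Lemma Jnu_concave L L' : in_QG G L -> in_QG G L' -> posT L -> posT L' ->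
  Jnu nu G W L' <= Jnu nu G W L + rtr ((L' - L) *m Dnu L).
Proof.
move=> hL hL' pL pL'; rewrite (Jnu_expand hL hL' pL pL') gerBl mulr_ge0//.
apply: circ_intR_ge0; first exact: bmR_klein.
move=> z hz; apply: klein_ge0.
- by apply: hermitian_Mnu; exact: in_QG_hermitian hL.
- by apply: hermitian_Mnu; exact: in_QG_hermitian hL'.
- exact: pL.
- exact: pL'.
Qed.

(* Since [pull X] determines [G^* X G], it vanishes a.e. only if [X] is
   orthogonal to the whole moment space, hence to itself. *)
Lemma pull_null X : in_QG G X -> circ_intR (fun z => frob (pull X z)) <= 0 -> X = 0.
Proof.
move=> hX h0; apply: frob_eq0; rewrite leNgt; apply/negP => f0.
have /in_QGP[P [bP hP XE]] := hX.
(* Conjugating [P] by the inverse of [W] cancels the factors [W] in [pull X], so [tr (pull X S)]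
   integrates to [tr (X X)]. *)
pose S z := invmx (W z) *m P z *m ctr (invmx (W z)).
have bI : bmM (fun z => invmx (W z)) by apply: lipM_bmM; exact: lipM_inv.
have bS : bmM S by apply: bmM_mul; [exact: bmM_mul|exact: bmM_ctr].
have [B B0 hB] := frob_bmM bS.
have fX : frob X = circ_intR (fun z => rtr (pull X z *m S z)).
  rewrite frobE (in_QG_hermitian lG hX) {2}XE rtr_dual//.
  apply: eq_circ_intR => z hz; rewrite /pull /S ctrM.
  rewrite !mulmxA (mulmxK (uW hz)) [RHS]rtrC !mulmxA -ctrM.
  by rewrite (mulmxV (uW hz)) ctr1 mul1mx.
(* With this [t], Young's inequality gives [2 frob X <= t^-1 B <= frob X], contradicting
   [frob X > 0]. *)
pose t := (B + 1) / frob X.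
have t0 : 0 < t by rewrite divr_gt0//; lra.
have bp : bmR (fun z => frob (pull X z)) by apply: bmR_frob; exact: bmM_pull.
have bS' : bmR (fun z => rtr (pull X z *m S z)).
  by apply: bmR_rtr; apply: bmM_mul => //; exact: bmM_pull.
have : circ_intR (fun z => 2 * rtr (pull X z *m S z)) <=
       circ_intR (fun z => t * frob (pull X z) + t^-1 * B).
  apply: le_circ_intR.
  - exact: bmRZ.
  - by apply: bmRD; [exact: bmRZ|exact: bmR_cst].
  - move=> z hz; apply: le_trans (rtr_mul_le _ _ t0) _.
    by rewrite lerD2l ler_wpM2l ?hB// invr_ge0 ltW.
rewrite circ_intRZ// circ_intRD; [|exact: bmRZ|exact: bmR_cst].
rewrite circ_intRZ// circ_intR_cst -fX => h.
have : t * circ_intR (fun z => frob (pull X z)) <= 0.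
  by rewrite pmulr_rle0.
have : t^-1 * B <= frob X.
  rewrite /t invf_div mulrAC ler_pdivrMr ?ler_pM2l//; lra.
move=> *; lra.
Qed.

Lemma Mnu_qf_bound L : exists2 c : R, 0 < c & forall z, onT z -> forall u,
  qf (Mn L z) u <= c * frob u.
Proof.
have [K K0 hK] := frob_bmM (lipM_bmM (lipM_Mnu L)).
exists (K + 1) => [|z hz u]; first by lra.
apply: le_trans (ler_norm _) _; apply: le_trans (qf_le_frob _ _) _.
by rewrite ler_wpM2r ?frob_ge0// lerD2r hK.
Qed.

Lemma critical_unique L L' : in_QG G L -> in_QG G L' -> posT L -> posT L' ->
  Dnu L = 0 -> Jnu nu G W L <= Jnu nu G W L' -> L' = L.
Proof.
move=> hL hL' pL pL' D0; rewrite (Jnu_expand hL hL' pL pL') D0 mulmx0 mxtrace0 /=.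
rewrite addr0 lerBrDr gerDl pmulr_rle0 ?divr_gt0// => hk.
have [c c0 hc] := Mnu_qf_bound L; have [c' c'0 hc'] := Mnu_qf_bound L'.
pose a := c + c'; have a0 : 0 < a by rewrite addr_gt0.
have hX : in_QG G (L' - L).
  rewrite -scaleN1r -[-1](_ : toC (-1) = -1).
    by apply: in_QGD => //; exact: in_QGZ.
  by apply/eqP; rewrite eq_complex /= oppr0 !eqxx.
apply/eqP; rewrite -subr_eq0; apply/eqP/pull_null => //.
have bp : bmR (fun z => frob (pull (L' - L) z)) by apply: bmR_frob; exact: bmM_pull.
(* The constant of [klein_ge] for the common upper bound [a], times [nu^-2] because [M(L') - M(L)]
   is [nu^-1] times the pullback of [L' - L]. *)
pose k := N.+1%:R * a^-1 ^+ N.+3 * nu%:R^-1 ^+ 2 : R.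
have k0 : 0 < k.
  apply: mulr_gt0; last by rewrite exprn_gt0// invr_gt0.
  by apply: mulr_gt0 => //; rewrite exprn_gt0// invr_gt0.
rewrite -(pmulr_rle0 _ k0) -circ_intRZ//; apply: le_trans hk.
apply: le_circ_intR; [exact: bmRZ|exact: bmR_klein|move=> z hz].
rewrite /k -[leLHS]mulrA -frobZ -MnuB; apply: klein_ge.
- by apply: hermitian_Mnu; exact: in_QG_hermitian hL.
- by apply: hermitian_Mnu; exact: in_QG_hermitian hL'.
- move=> u u0; rewrite pL//= /a mulrDl (le_trans (hc _ hz u))// lerDl.
  by rewrite mulr_ge0 ?frob_ge0// ltW.
- move=> u u0; rewrite pL'//= /a mulrDl (le_trans (hc' _ hz u))// lerDr.
  by rewrite mulr_ge0 ?frob_ge0// ltW.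
Qed.

(** A uniform and closed form of positivity: upper bounds on the Klein remainder need it, and it
    defines a closed set. *)
Definition geT (d : R) L := forall z, onT z -> forall u, d * frob u <= qf (Mn L z) u.

Lemma geT_posT d L : 0 < d -> geT d L -> posT L.
Proof.
move=> d0 h z hz u u0; apply: lt_le_trans (h z hz u).
by rewrite mulr_gt0// frob_gt0.
Qed.

(** A minorant with the same linear term as the majorant [Jnu_concave]. It drives the ascent step
    and, paired with the majorant, gives continuity. *)
Lemma Jnu_lower (d : R) : 0 < d -> exists2 c, 0 <= c &
  forall L L', in_QG G L -> in_QG G L' -> geT d L -> geT d L' ->
  Jnu nu G W L + rtr ((L' - L) *m Dnu L)
    - c * circ_intR (fun z => frob (pull (L' - L) z)) <= Jnu nu G W L'.
Proof.
move=> d0; have [c c0 hc] := @klein_le R m N d d0.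
exists (nu%:R / N.+1%:R * (c * nu%:R^-1 ^+ 2)) => [|L L' hL hL' gL gL'].
  by rewrite !mulr_ge0 ?exprn_ge0 ?invr_ge0.
have pL := geT_posT d0 gL; have pL' := geT_posT d0 gL'.
rewrite (Jnu_expand hL hL' pL pL') lerD2l lerN2 -[leRHS]mulrA.
have bp : bmR (fun z => frob (pull (L' - L) z)) by apply: bmR_frob; exact: bmM_pull.
apply: ler_wpM2l; first by rewrite divr_ge0.
rewrite -circ_intRZ//; apply: le_circ_intR; [exact: bmR_klein|exact: bmRZ|move=> z hz].
rewrite -[leRHS]mulrA -frobZ -MnuB; apply: hc.
- by apply: hermitian_Mnu; exact: in_QG_hermitian hL.
- by apply: hermitian_Mnu; exact: in_QG_hermitian hL'.
- exact: gL.
- exact: gL'.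
Qed.

Lemma first_order (d : R) L : 0 < d -> in_QG G L -> geT d L ->
  (forall L', in_QG G L' -> posT L' -> Jnu nu G W L' <= Jnu nu G W L) ->
  Dnu L = 0.
Proof.
move=> d0 hL gL maxL; have pL := geT_posT d0 gL.
have hD := in_QG_Dnu hL pL; set X := Dnu L in hD *.
have [B B0 hB] := frob_bmM (bmM_pull X).
have d2 : 0 < d / 2 by lra.
have [c c0 hc] := Jnu_lower d2.
apply: frob_eq0; rewrite leNgt; apply/negP => f0.
(* The first bound keeps the moved point uniformly positive with constant [d / 2]; the second makes
   the linear gain exceed the quadratic loss. *)
pose t := Num.min (d / 2 / (B + 1)) (frob X / (2 * (c * B + 1))).
have cB : 0 <= c * B by rewrite mulr_ge0.
have t0 : 0 < t by rewrite lt_min !divr_gt0//; lra.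
have t1 : t * (B + 1) <= d / 2 by rewrite -ler_pdivlMr ?ge_min ?lexx//; lra.
have t2 : t * (2 * (c * B + 1)) <= frob X.
  by rewrite -ler_pdivlMr ?ge_min ?lexx ?orbT//; lra.
have hL' : in_QG G (L + toC t *: X) by apply: in_QGD => //; exact: in_QGZ.
have gL2 : geT (d / 2) L.
  by move=> z hz u; apply: le_trans (gL z hz u); rewrite ler_wpM2r ?frob_ge0//; lra.
have gL' : geT (d / 2) (L + toC t *: X).
  move=> z hz u; rewrite MnuD pullZ qfD qfZ qfZ.
  have := gL z hz u; have := qf_le_frob (pull X z) u.
  rewrite ler_norml => /andP[h1 _] h2; have u0 := frob_ge0 u.
  have i0 : 0 <= nu%:R^-1 :> R by rewrite invr_ge0.
  have i1 : nu%:R^-1 <= 1 :> R by rewrite invf_le1// ler1n.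
  have h3 : - ((B + 1) * frob u) <= qf (pull X z) u.
    by apply: le_trans h1; rewrite lerN2 ler_wpM2r// lerD2r hB.
  have h4 : - (d / 2 * frob u) <= t * qf (pull X z) u.
    by apply: le_trans (ler_wpM2l (ltW t0) h3); rewrite mulrN lerN2 mulrA ler_wpM2r.
  have h5 : - (d / 2 * frob u) <= nu%:R^-1 * (t * qf (pull X z) u).
    apply: le_trans (ler_wpM2l i0 h4); rewrite mulrN lerN2 ler_piMl//.
    by rewrite mulr_ge0// ltW.
  have -> : d / 2 * frob u = d * frob u - d / 2 * frob u by field.
  exact: lerD.
have := hc _ _ hL hL' gL2 gL'; have := maxL _ hL' (geT_posT d2 gL').
rewrite [L + _ - L]addrC addKr.
have bp : bmR (fun z => frob (pull X z)) by apply: bmR_frob; exact: bmM_pull.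
have E1 : circ_intR (fun z => frob (pull (toC t *: X) z)) =
          t ^+ 2 * circ_intR (fun z => frob (pull X z)).
  by rewrite -circ_intRZ//; apply: eq_circ_intR => z _; rewrite pullZ frobZ.
have E2 : rtr (toC t *: X *m Dnu L) = t * frob X.
  by rewrite -scalemxAl rtrZ frobE (in_QG_hermitian lG hD).
rewrite E1 E2 => j1 j2; have iB := circ_intR_le bp hB.
exact: first_order_contra j1 j2 iB c0 t0 t2 f0.
Qed.

End DualFunctional.

(** * Logarithmic growth of the integral of an inverse tent function *)

Section LogEstimate.
Variable R : realType.
Local Notation C := R[i].
Local Open Scope classical_set_scope.
Local Notation mu := (@lebesgue_measure R).

Lemma integral_inv_affine (a b c e : R) : a < b -> e != 0 ->
  (forall t, a <= t <= b -> 0 < c + e * t) ->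
  (\int[mu]_(t in `[a, b]) ((c + e * t)^-1)%:E =
    ((ln (c + e * b) - ln (c + e * a)) / e)%:E)%E.
Proof.
move=> ab e0 pos.
pose F (t : R) : R := ln (c + e * t) * e^-1.
have dA (t : R) : is_derive t 1 (fun t => c + e * t) e.
  have -> : (fun t : R => c + e * t) = cst c + e *: id by [].
  by apply: is_derive_eq; rewrite add0r /GRing.scale /= mulr1.
have dF (t : R) : a <= t <= b -> is_derive t 1 F (c + e * t)^-1.
  move=> /pos p.
  have d1 : is_derive (c + e * t) 1 (@ln R) (c + e * t)^-1 by exact: is_derive1_ln.
  have d2 : is_derive t 1 (@ln R \o (fun t => c + e * t)) ((c + e * t)^-1 * e).
    exact: is_derive1_comp.
  have -> : F = e^-1 *: (@ln R \o (fun t => c + e * t)).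
    by apply/funext => s; rewrite /F /= mulrC.
  by apply: is_derive_eq; rewrite /GRing.scale /=; field; rewrite e0 gt_eqF.
have cF (t : R) : a <= t <= b -> {for t, continuous F}.
  move=> h; apply: differentiable_continuous; apply/derivable1_diffP.
  by have [] := dF t h.
rewrite (@continuous_FTC2 R (fun t => (c + e * t)^-1) F a b)//.
- by rewrite /F -EFinB -mulrBl.
- apply: continuous_in_subspaceT => t; rewrite inE /= in_itv /= => h.
  apply: cvgV; first by rewrite gt_eqF ?pos.
  by apply: cvgD; [exact: cvg_cst|apply: cvgM; [exact: cvg_cst|exact: cvg_id]].
- split.
  + move=> t; rewrite in_itv /= => /andP[h1 h2].
    have h : a <= t <= b by rewrite (ltW h1) (ltW h2).
    by have [] := dF t h.
  + by apply: cvg_at_right_filter; apply: cF; rewrite lexx ltW.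
  + by apply: cvg_at_left_filter; apply: cF; rewrite lexx ltW.
- move=> t; rewrite in_itv /= => /andP[h1 h2]; rewrite derive1E.
  have h : a <= t <= b by rewrite (ltW h1) (ltW h2).
  by have [_ ->] := dF t h.
Qed.

Lemma integral_circle_ge (f : C -> R) (g : R -> R) (a b v : R) : bmR f ->
  - pi <= a -> b <= pi -> (forall t, 0 <= f (expi t)) ->
  (\int[mu]_(t in `[a, b]) (g t)%:E = v%:E)%E ->
  measurable_fun `[a, b] g ->
  (forall t, a <= t <= b -> 0 <= g t <= f (expi t)) ->
  v <= 2 * pi * circ_intR f.
Proof.
move=> bf pa bp f0 gv mg gf.
have -> : 2 * pi * circ_intR f = Rintegral mu `[- pi, pi] (f \o @expi R).
  by rewrite /circ_intR mulVKf// mulf_neq0// gt_eqF// pi_gt0.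
have fin : (\int[mu]_(t in `[(- pi)%R, pi%R]) (EFin \o (f \o @expi R)) t)%E \is a fin_num.
  by apply: integrable_fin_num => //; exact: integrable_bmR.
have mf : measurable_fun setT (EFin \o (f \o @expi R)).
  by apply/measurable_EFinP; case: bf.
rewrite -lee_fin -gv /Rintegral fineK//.
apply: (@le_trans _ _ (\int[mu]_(t in `[a, b]) (f (expi t))%:E)%E).
  apply: ge0_le_integral => //=.
  - by move=> t; rewrite in_itv /= => /gf/andP[h _]; rewrite lee_fin.
  - exact/measurable_EFinP.
  - exact: measurable_funTS.
  - by move=> t; rewrite in_itv /= => /gf/andP[_ h]; rewrite lee_fin.
apply: ge0_subset_integral => //.
- exact: measurable_funTS.
- by move=> t _; rewrite lee_fin.
move=> t /=; rewrite !in_itv /= => /andP[h1 h2].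
by rewrite (le_trans pa h1) (le_trans h2 bp).
Qed.

(** Only a unit interval on one side of [t0] is integrated, where [|t - t0|] is affine. The side is
    chosen by the sign of [t0], and the interval stays in [[-pi, pi]] because [pi >= 2]. *)
Lemma log_lower (f : C -> R) (q k t0 : R) : bmR f -> 0 < q -> 0 < k ->
  - pi <= t0 <= pi -> (forall t, (q + k * `|t - t0|)^-1 <= f (expi t)) ->
  (ln (q + k) - ln q) / k <= 2 * pi * circ_intR f.
Proof.
move=> bf q0 k0 /andP[t1 t2] hf; have p2 := pi_ge2 R.
have den t : 0 < q + k * `|t - t0| by rewrite ltr_pwDl// mulr_ge0// ltW.
have f0 t : 0 <= f (expi t).
  by apply: le_trans (hf t); rewrite invr_ge0 ltW.
have meas (c e a b : R) : (forall t, a <= t <= b -> 0 < c + e * t) ->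
    measurable_fun `[a, b] (fun t => (c + e * t)^-1).
  move=> pos; apply: subspace_continuous_measurable_fun => //.
  apply: continuous_in_subspaceT => t; rewrite inE /= in_itv /= => h.
  apply: cvgV; first by rewrite gt_eqF ?pos.
  by apply: cvgD; [exact: cvg_cst|apply: cvgM; [exact: cvg_cst|exact: cvg_id]].
have [ht|ht] := leP t0 0.
  pose c := q - k * t0.
  have pos t : t0 <= t <= t0 + 1 -> 0 < c + k * t.
    by move=> /andP[h _]; rewrite /c; nra.
  have := @integral_inv_affine t0 (t0 + 1) c k _ (lt0r_neq0 k0) pos.
  rewrite (_ : c + k * (t0 + 1) = q + k); last by rewrite /c; ring.
  rewrite (_ : c + k * t0 = q); last by rewrite /c; ring.
  move=> /(_ ltac:(lra)) E.
  apply: (integral_circle_ge bf _ _ f0 E) => //; [lra|exact: meas|].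
  move=> t h; rewrite invr_ge0 (ltW (pos _ h)) /=.
  apply: le_trans (hf t); case/andP: h => h _.
  by rewrite ger0_norm ?subr_ge0// (_ : c + k * t = q + k * (t - t0))// /c; ring.
pose c := q + k * t0.
have pos t : t0 - 1 <= t <= t0 -> 0 < c + - k * t.
  by move=> /andP[_ h]; rewrite /c; nra.
have k1 : - k != 0 by rewrite oppr_eq0 lt0r_neq0.
have := @integral_inv_affine (t0 - 1) t0 c (- k) _ k1 pos.
rewrite (_ : c + - k * (t0 - 1) = q + k); last by rewrite /c; ring.
rewrite (_ : c + - k * t0 = q); last by rewrite /c; ring.
rewrite (_ : (ln q - ln (q + k)) / - k = (ln (q + k) - ln q) / k); last first.
  by field; rewrite gt_eqF.
move=> /(_ ltac:(lra)) E.
apply: (integral_circle_ge bf _ _ f0 E) => //; [lra|exact: meas|].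
move=> t h; rewrite invr_ge0 (ltW (pos _ h)) /=.
apply: le_trans (hf t); case/andP: h => _ h.
rewrite ler0_norm ?subr_le0//.
by rewrite (_ : c + - k * t = q + k * - (t - t0))// /c; ring.
Qed.

(** Exponentiating gives [k <= q + k <= q exp(B k)]: a bound on the integral becomes a lower bound
    on [q]. *)
Lemma log_lower_inv (q k B : R) : 0 < q -> 0 < k -> (ln (q + k) - ln q) / k <= B ->
  k * expR (- (B * k)) <= q.
Proof.
move=> q0 k0; rewrite ler_pdivrMr// lerBlDr => h.
have qk : 0 < q + k by rewrite addr_gt0.
have : expR (ln (q + k)) <= expR (B * k + ln q) by rewrite ler_expR.
rewrite expRD !lnK ?posrE// => h2.
rewrite expRN ler_pdivrMr ?expR_gt0// mulrC.
by apply: le_trans h2; rewrite lerDr ltW.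
Qed.

End LogEstimate.

(** * A priori bounds on the superlevel set *)

Section Coercivity.
Variable R : realType.
Local Notation C := R[i].

Lemma rtr_inv_pow_ge0 k (M : 'M[C]_k) e : Defs.hermitian M ->
  (forall u, u != 0 -> 0 < qf M u) -> 0 <= rtr (invmx (mxpow M e)).
Proof.
move=> /hermitian_specP[U [d [uU ->]]] /(spec_gt0 uU) d0.
have h i : 0 < d i ^+ e by rewrite exprn_gt0.
rewrite mxpow_spec// invmx_spec//; last by move=> i; rewrite gt_eqF.
rewrite -[X in rtr X]mulmx1 -(spec1 uU) rtr_spec_mul; apply: sumr_ge0 => i _.
by rewrite qf_spec_col// mulr1 invr_ge0 ltW.
Qed.

Lemma rtr_mul_ge_scalar k (b : R) (Y P : 'M[C]_k) : Defs.hermitian Y ->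
  (forall u, 0 <= qf Y u) -> (forall u, b * frob u <= qf P u) ->
  b * rtr Y <= rtr (Y *m P).
Proof.
move=> hY pY hP; rewrite -subr_ge0.
have -> : rtr (Y *m P) - b * rtr Y = rtr (Y *m (P - (toC b)%:M)).
  by rewrite mulmxBr rtrB mul_mx_scalar rtrZ.
by apply: rtr_psd_mul => // u; rewrite qfB qf_scalar subr_ge0.
Qed.

Lemma rtr_mul_le_scalar k (b : R) (Y P : 'M[C]_k) : Defs.hermitian Y ->
  (forall u, 0 <= qf Y u) -> (forall u, qf P u <= b * frob u) ->
  rtr (Y *m P) <= b * rtr Y.
Proof.
move=> hY pY hP; rewrite -subr_ge0.
have -> : b * rtr Y - rtr (Y *m P) = rtr (Y *m ((toC b)%:M - P)).
  by rewrite mulmxBr rtrB mul_mx_scalar rtrZ.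
by apply: rtr_psd_mul => // u; rewrite qfB qf_scalar subr_ge0.
Qed.

Lemma rtr_psd_ge0 k (Y : 'M[C]_k) : Defs.hermitian Y ->
  (forall u, 0 <= qf Y u) -> 0 <= rtr Y.
Proof.
move=> hY pY; rewrite -[Y]mulmx1; apply: rtr_psd_mul => // u.
by rewrite -[1%:M]/((toC 1)%:M) qf_scalar mul1r frob_ge0.
Qed.

Lemma qf_expi_lipschitz k (F : C -> 'M[C]_k) : lipM F ->
  exists2 K : R, 0 <= K & forall s t u, frob u = 1 ->
    `|qf (F (expi s)) u - qf (F (expi t)) u| <= K * `|s - t|.
Proof.
move=> lF.
have /choice[K hK] : forall ij : 'I_k * 'I_k, exists K : R, 0 <= K /\ forall s t,
    `|F (expi s) ij.1 ij.2 - F (expi t) ij.1 ij.2| <= toC (K * `|s - t|).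
  by move=> [i j]; have [K K0 h] := lipT_expi (lF i j); exists K.
pose B := \sum_ij K ij.
have K0 ij : 0 <= K ij by have [] := hK ij.
have B0 : 0 <= B by apply: sumr_ge0.
have KB ij : K ij <= B by rewrite /B (bigD1 ij)//= lerDl sumr_ge0.
exists ((2 * B ^+ 2) *+ (k * k) + 1).
  by rewrite addr_ge0// mulrn_wge0// mulr_ge0// sqr_ge0.
move=> s t u u1; have [->|st] := eqVneq s t.
  by rewrite !subrr normr0 mulr0.
have h0 : 0 < `|s - t| by rewrite normr_gt0 subr_eq0.
set h := `|s - t| in h0 *.
(* The bound [frob A + 1] is not homogeneous, so it is applied to the difference quotient rather
   than to the difference. *)
pose A := toC h^-1 *: (F (expi s) - F (expi t)).
have -> : qf (F (expi s)) u - qf (F (expi t)) u = h * qf A u.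
  by rewrite -qfB /A qfZ mulrA mulfV ?mul1r// gt_eqF.
rewrite normrM gtr0_norm// mulrC ler_pM2r//.
apply: le_trans (qf_le_frob _ _) _; rewrite u1 mulr1 lerD2r.
apply: frob_bound => i j.
have [_ /(_ s t) /= hh] := hK (i, j).
have : `|A i j| <= toC B.
  rewrite /A !mxE normrM norm_toC [`|h^-1|]gtr0_norm ?invr_gt0//.
  apply: le_trans (_ : toC h^-1 * toC (K (i, j) * h) <= _).
    by apply: ler_wpM2l => //; rewrite lecR invr_ge0 ltW.
  by rewrite -toCM lecR mulrCA mulVf ?mulr1// gt_eqF.
move=> AB; split; rewrite -lecR.
  exact: le_trans (Re_le_norm _) AB.
exact: le_trans (Im_le_norm _) AB.
Qed.

Lemma qf_scale k (a : R) (M : 'M[C]_k) u : qf M (toC a *: u) = a ^+ 2 * qf M u.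
Proof.
by rewrite !qfE ctrZ -scalemxAl -!scalemxAr !rtrZ mulrA expr2.
Qed.

Lemma fin_bound (T : Type) K (Q : T -> Prop) (f : 'I_K -> T -> R) :
  (forall k, exists r : R, forall x, Q x -> f k x <= r) ->
  exists2 r : R, 0 < r & forall x, Q x -> forall k, f k x <= r.
Proof.
move=> /choice[r hr]; exists (\sum_k `|r k| + 1).
  by rewrite ltr_pwDr// sumr_ge0.
move=> x Qx k; apply: le_trans (hr k x Qx) _.
rewrite (bigD1 k)//= -addrA (le_trans (ler_norm _))// lerDl addr_ge0//.
by rewrite sumr_ge0.
Qed.

Variables (n m N : nat) (G : C -> 'M[C]_(n, m)) (W : C -> 'M[C]_m).
Hypotheses (lG : lipM G) (lW : lipM W).
Hypothesis uW : forall z, onT z -> W z \in unitmx.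
Variable Phi0 : C -> 'M[C]_m.
Hypothesis sPhi0 : spec_density Phi0.
Hypothesis mPhi0 : circ_intmx (fun z => G z *m Phi0 z *m ctr (G z)) = 1%:M.
Local Notation nu := N.+2.
Local Notation Mn := (Mnu nu G W).
Local Notation pos := (posT N G W).
Implicit Types (L X : 'M[C]_n).

(* [W^-* M W^-1 = (W W^* )^-1 + nu^-1 G^* L G] is free of [W] in its
   dependence on [L], which makes the moment constraint on [Phi0] usable. *)
Definition whitened L z : 'M[C]_m := ctr (invmx (W z)) *m Mn L z *m invmx (W z).
Definition winv_gram z : 'M[C]_m := ctr (invmx (W z)) *m invmx (W z).

Lemma moment_whitened L z : onT z ->
  ctr (G z) *m L *m G z = toC nu%:R *: (whitened L z - winv_gram z).
Proof.
move=> hz.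
have -> : whitened L z = winv_gram z + toC nu%:R^-1 *: (ctr (G z) *m L *m G z).
  rewrite /whitened MnuE mulmxDr mulmxDl mulmx1; congr (_ + _).
  rewrite -scalemxAr -scalemxAl; congr (_ *: _).
  by rewrite /pull !mulmxA -ctrM !(mulmxK (uW hz)).
rewrite addrC addKr scalerA -toCM mulfV ?pnatr_eq0//.
by rewrite (_ : toC 1 = 1)// scale1r.
Qed.

Let bI : bmM (fun z => invmx (W z)).
Proof. by apply: lipM_bmM; exact: lipM_inv. Qed.

Lemma bmM_whitened L : bmM (whitened L).
Proof.
apply: bmM_mul => //; apply: bmM_mul; first exact: bmM_ctr.
exact/lipM_bmM/lipM_Mnu.
Qed.

Lemma bmM_winv_gram : bmM winv_gram.
Proof. by apply: bmM_mul => //; exact: bmM_ctr. Qed.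

Lemma moment_eq L (P : C -> 'M[C]_m) : bmM P ->
  rtr (L *m circ_intmx (fun z => G z *m P z *m ctr (G z))) =
  nu%:R * (circ_intR (fun z => rtr (whitened L z *m P z)) -
           circ_intR (fun z => rtr (winv_gram z *m P z))).
Proof.
move=> bP; rewrite rtr_dual//.
have b1 : bmR (fun z => rtr (whitened L z *m P z)).
  by apply: bmR_rtr; apply: bmM_mul => //; exact: bmM_whitened.
have b2 : bmR (fun z => rtr (winv_gram z *m P z)).
  by apply: bmR_rtr; apply: bmM_mul => //; exact: bmM_winv_gram.
rewrite -circ_intRB// -circ_intRZ; last exact: bmRB.
apply: eq_circ_intR => z hz; rewrite moment_whitened// -scalemxAl rtrZ mulmxBl.
by rewrite rtrB.
Qed.

Lemma hermitian_whitened L z : Defs.hermitian L -> Defs.hermitian (whitened L z).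
Proof. by move=> hL; apply: hermitian_congr; exact: hermitian_Mnu. Qed.

Lemma whitened_ge0 L z u : pos L -> onT z -> 0 <= qf (whitened L z) u.
Proof.
move=> pL hz; rewrite /whitened qf_congr.
have [->|v0] := eqVneq (invmx (W z) *m u) 0; first by rewrite qf_0.
by apply: ltW; exact: pL.
Qed.

Let J0 := Jnu nu G W (0 : 'M[C]_n).

Definition superlevel L := [/\ in_QG G L, pos L & J0 <= Jnu nu G W L].

(** Pairing [L] with the moment of [Phi0] gives [tr L = nu (int tr (whitened L Phi0) - s)]. So
    [J(L) >= J(0)] bounds a sum of two nonnegative terms by [T], hence each of them: one controls
    the inverse power since [nu/(nu-1) >= 1], the other [int tr (whitened L)] since [Phi0 >= e]. *)
Lemma superlevel_integrals : exists2 c : R, 0 <= c & forall L, superlevel L ->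
  circ_intR (fun z => rtr (whitened L z)) <= c /\
  circ_intR (fun z => rtr (invmx (mxpow (Mn L z) N.+1))) <= c.
Proof.
have [bP hP] := spec_density_bmM sPhi0.
have [_ _ [e [e0 pe]] _] := sPhi0.
have eP z : onT z -> forall u, e * frob u <= qf (Phi0 z) u.
  move=> hz u; rewrite -subr_ge0 -qf_scalar -qfB.
  exact: (cpsd_qf (pe z hz)).
pose s := circ_intR (fun z => rtr (winv_gram z *m Phi0 z)).
pose T := nu%:R * s - J0.
exists (`|T| + `|T| / (nu%:R * e)).
  by rewrite addr_ge0// divr_ge0// mulr_ge0// ltW.
move=> L [hL pL]; rewrite JnuE.
have hhL := in_QG_hermitian lG hL.
have -> : rtr L = nu%:R * (circ_intR (fun z => rtr (whitened L z *m Phi0 z)) - s).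
  by rewrite -[X in rtr X]mulmx1 -mPhi0 moment_eq.
have bY : bmR (fun z => rtr (whitened L z)) by apply: bmR_rtr; exact: bmM_whitened.
have : e * circ_intR (fun z => rtr (whitened L z)) <= circ_intR (fun z => rtr (whitened L z *m Phi0 z)).
  rewrite -circ_intRZ//; apply: le_circ_intR.
  - exact: bmRZ.
  - by apply: bmR_rtr; apply: bmM_mul => //; exact: bmM_whitened.
  - move=> z hz; apply: rtr_mul_ge_scalar; [exact: hermitian_whitened| |exact: eP].
    by move=> u; exact: whitened_ge0.
have : 0 <= circ_intR (fun z => rtr (invmx (mxpow (Mn L z) N.+1))).
  apply: circ_intR_ge0.
    by apply: bmR_rtr; apply: lipM_bmM; exact: lipM_inv_pow.
  by move=> z hz; apply: rtr_inv_pow_ge0; [exact: hermitian_Mnu|exact: pL].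
have : 0 <= circ_intR (fun z => rtr (whitened L z)).
  apply: circ_intR_ge0 => // z hz; apply: rtr_psd_ge0; first exact: hermitian_whitened.
  by move=> u; exact: whitened_ge0.
move: (circ_intR (fun z => rtr (whitened L z))) => y.
move: (circ_intR (fun z => rtr (whitened L z *m Phi0 z))) => yp.
move: (circ_intR (fun z => rtr (invmx (mxpow (Mn L z) N.+1)))) => I.
move=> y0 I0 yyp JT.
have n0 : 0 < nu%:R :> R by rewrite ltr0n.
have k0 : 0 < N.+1%:R :> R by rewrite ltr0n.
have hI : I <= nu%:R / N.+1%:R * I.
  by rewrite ler_peMl// ler_pdivlMr// mul1r ler_nat.
have hT : nu%:R / N.+1%:R * I + nu%:R * (e * y) <= T.
  rewrite /T; have : nu%:R * (e * y) <= nu%:R * yp by rewrite ler_pM2l.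
  move: JT; rewrite invrN mulrN mulNr mulrBr.
  by move: (nu%:R / N.+1%:R * I) => aI; move: (nu%:R * s) (nu%:R * yp) => *; lra.
have ney : 0 <= nu%:R * (e * y) by exact: mulr_ge0 (ltW n0) (mulr_ge0 (ltW e0) y0).
have TT := ler_norm T.
have ne0 : 0 < nu%:R * e by rewrite mulr_gt0.
split.
  apply: (@le_trans _ _ (`|T| / (nu%:R * e))); last by rewrite lerDr.
  rewrite ler_pdivlMr// mulrC -mulrA; apply: le_trans TT; apply: le_trans hT.
  by rewrite lerDr; apply: le_trans hI.
apply: (@le_trans _ _ `|T|); last by rewrite lerDl divr_ge0// ltW.
by apply: le_trans hI _; apply: le_trans TT; apply: le_trans hT; rewrite lerDl.
Qed.

(** Writing [E] as a moment of [P] makes the coordinate an integral of [tr (whitened L P)], up to a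
    constant; as [whitened L] is positive semidefinite, this is at most a multiple of its integrated
    trace. *)
Lemma superlevel_coord E : in_QG G E ->
  exists r : R, forall L, superlevel L -> `|rtr (L *m E)| <= r.
Proof.
move=> /in_QGP[P [bP hP ->]].
have [c c0 hc] := superlevel_integrals.
have [B B0 hB] := frob_bmM bP.
pose s := circ_intR (fun z => rtr (winv_gram z *m P z)).
exists (nu%:R * ((B + 1) * c + `|s|)) => L sL.
have [hL pL _] := sL; have [yc _] := hc L sL.
have hhL := in_QG_hermitian lG hL.
rewrite moment_eq// normrM ger0_norm// ler_wpM2l//.
apply: le_trans (ler_normB _ _) _; rewrite lerD2r.
have bY : bmR (fun z => rtr (whitened L z)) by apply: bmR_rtr; exact: bmM_whitened.
have bYP : bmR (fun z => rtr (whitened L z *m P z)).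
  by apply: bmR_rtr; apply: bmM_mul => //; exact: bmM_whitened.
have qB z u : onT z -> `|qf (P z) u| <= (B + 1) * frob u.
  move=> hz; apply: le_trans (qf_le_frob _ _) _.
  by rewrite ler_wpM2r ?frob_ge0// lerD2r hB.
have B1 : 0 <= B + 1 by lra.
apply: (@le_trans _ _ ((B + 1) * circ_intR (fun z => rtr (whitened L z)))); last first.
  exact: ler_wpM2l.
rewrite ler_norml; apply/andP; split.
  rewrite -mulNr -circ_intRZ//; apply: le_circ_intR => //; first exact: bmRZ.
  move=> z hz; apply: rtr_mul_ge_scalar; first exact: hermitian_whitened.
    by move=> u; exact: whitened_ge0.
  by move=> u; have := qB z u hz; rewrite ler_norml mulNr => /andP[].
rewrite -circ_intRZ//; apply: le_circ_intR => //; first exact: bmRZ.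
move=> z hz; apply: rtr_mul_le_scalar; first exact: hermitian_whitened.
  by move=> u; exact: whitened_ge0.
by move=> u; have := qB z u hz; rewrite ler_norml => /andP[].
Qed.

Variables (K : nat) (E : 'I_K -> 'M[C]_n).
Hypothesis hE : forall k, in_QG G (E k).
Hypothesis basisE : forall L, in_QG G L -> L = \sum_k toC (rtr (L *m E k)) *: E k.

Definition comb (x : 'rV[R]_K) : 'M[C]_n := \sum_k toC (x 0 k) *: E k.

Lemma qf_Mnu_comb (x : 'rV[R]_K) z u : qf (Mn (comb x) z) u =
  frob u + nu%:R^-1 * \sum_k x 0 k * qf (pull G W (E k) z) u.
Proof.
rewrite MnuE qfD qfZ -[1%:M]/((toC 1)%:M) qf_scalar mul1r; congr (_ + _ * _).
rewrite /pull /comb mulmx_sumr mulmx_suml qfE mulmx_suml rtr_sum.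
by apply: eq_bigr => k _; rewrite -scalemxAr -scalemxAl -scalemxAl rtrZ qfE.
Qed.

Lemma comb_coord L : in_QG G L -> L = comb (\row_k rtr (L *m E k)).
Proof.
move=> hL; rewrite {1}(basisE hL); apply: eq_bigr => k _; by rewrite mxE.
Qed.

Lemma superlevel_bounds : exists r d : R, [/\ 0 < r, 0 < d &
  forall L, superlevel L ->
    (forall k, `|rtr (L *m E k)| <= r) /\ geT N G W d L].
Proof.
have [r r0 hr] : exists2 r : R, 0 < r & forall L, superlevel L ->
    forall k, `|rtr (L *m E k)| <= r.
  by apply: fin_bound => k; exact: superlevel_coord.
have [c c0 hc] := superlevel_integrals.
have [Q Q0 hQ] : exists2 Q : R, 0 < Q & forall k s t u, frob u = 1 ->
    `|qf (pull G W (E k) (expi s)) u - qf (pull G W (E k) (expi t)) u| <= Q * `|s - t|.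
  have /choice[Q hQ] : forall k, exists Q : R, 0 <= Q /\ forall s t u, frob u = 1 ->
    `|qf (pull G W (E k) (expi s)) u - qf (pull G W (E k) (expi t)) u| <= Q * `|s - t|.
    move=> k; have [Q Q0 h] := qf_expi_lipschitz (lipM_pull lG lW (E k)).
    by exists Q.
  have Q0 k : 0 <= Q k by have [] := hQ k.
  exists (\sum_k Q k + 1) => [|k s t u u1]; first by rewrite ltr_pwDr// sumr_ge0.
  have [_ h] := hQ k; apply: le_trans (h s t u u1) _; rewrite ler_wpM2r//.
  by rewrite (bigD1 k)//= -addrA lerDl addr_ge0// sumr_ge0.
(* A Lipschitz constant in the angle, uniform over the superlevel set: each coordinate contributes
   at most [r * Q], and the [+ 1] keeps it positive even for an empty basis. *)
pose kp := \sum_(k < K) (r * Q) + 1.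
have kp0 : 0 < kp by rewrite ltr_pwDr// sumr_ge0// => ? _; rewrite mulr_ge0// ltW.
(* The value given by [log_lower_inv] for the integral bound [2 pi (c + 1)]; the extra 1 compensates
   the [- 1] in [rtr_inv_pow_ge]. *)
exists r, (kp * expR (- (2 * pi * (c + 1) * kp))).
split=> //; first by rewrite mulr_gt0// expR_gt0.
move=> L sL; split; first exact: hr.
have [hL pL _] := sL; have [_ Ic] := hc L sL.
have lipq s t u : frob u = 1 ->
    qf (Mn L (expi s)) u <= qf (Mn L (expi t)) u + kp * `|s - t|.
  move=> u1; rewrite (comb_coord hL) 2!qf_Mnu_comb -addrA lerD2l.
  rewrite -lerBlDl -mulrBr -sumrB.
  apply: (@le_trans _ _ (\sum_(k < K) r * Q * `|s - t|)); last first.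
    by rewrite -mulr_suml ler_wpM2r// /kp lerDl.
  have i1 : nu%:R^-1 <= 1 :> R by rewrite invf_le1// ler1n.
  have i0 : 0 <= nu%:R^-1 :> R by rewrite invr_ge0.
  (* The factor [1/nu <= 1] may be dropped only from a nonnegative sum; a negative sum is trivially
     below the bound. *)
  have [sg0|sg0] := leP 0 (\sum_k ((\row_k rtr (L *m E k)) 0 k * qf (pull G W (E k) (expi s)) u -
     (\row_k rtr (L *m E k)) 0 k * qf (pull G W (E k) (expi t)) u)); last first.
    apply: (@le_trans _ _ 0); first by rewrite mulr_ge0_le0// ltW.
    by apply: sumr_ge0 => k _; rewrite !mulr_ge0// ltW.
  apply: le_trans (ler_piMl sg0 i1) _; apply: ler_sum => k _.
  rewrite -mulrBr mxE -mulrA; apply: le_trans (ler_norm _) _; rewrite normrM.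
  by apply: ler_pM => //; [exact: hr|exact: hQ].
have unit_case z u : onT z -> frob u = 1 ->
    kp * expR (- (2 * pi * (c + 1) * kp)) <= qf (Mn L z) u.
  move=> hz u1.
  have u0 : u != 0.
    by apply/eqP => h; move: u1; rewrite h frob0 => /eqP; rewrite eq_sym oner_eq0.
  have q0 := pL z hz u u0; have [t0 t0I zE] := onT_expi hz.
  have bJ : bmR (fun z => rtr (invmx (mxpow (Mn L z) N.+1))).
    by apply: bmR_rtr; apply: lipM_bmM; exact: lipM_inv_pow.
  have bJ1 : bmR (fun z => rtr (invmx (mxpow (Mn L z) N.+1)) + 1).
    by apply: bmRD => //; exact: bmR_cst.
  apply: log_lower_inv => //.
  have low t : (qf (Mn L z) u + kp * `|t - t0|)^-1 <=
      rtr (invmx (mxpow (Mn L (expi t)) N.+1)) + 1.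
    have tT := expi_onT t.
    have := rtr_inv_pow_ge N (hermitian_Mnu N G W (expi t) (in_QG_hermitian lG hL))
      (pL _ tT) u1.
    rewrite lerBlDr; apply: le_trans.
    have qt0 := pL _ tT u u0.
    have den : 0 < qf (Mn L z) u + kp * `|t - t0|.
      exact: ltr_pwDl q0 (mulr_ge0 (ltW kp0) (normr_ge0 _)).
    rewrite lef_pV2; [|exact: den|exact: qt0].
    by rewrite zE; exact: lipq.
  apply: le_trans (log_lower bJ1 q0 kp0 t0I low) _.
  rewrite ler_wpM2l ?mulr_ge0 ?pi_ge0// circ_intRD//; last exact: bmR_cst.
  by rewrite circ_intR_cst lerD2r.
move=> z hz u; have [->|u0] := eqVneq u 0; first by rewrite frob0 mulr0 qf_0.
have f0 := frob_gt0 u0.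
pose a := (Num.sqrt (frob u))^-1.
have a2 : a ^+ 2 * frob u = 1.
  by rewrite /a exprVn sqr_sqrtr ?(ltW f0)// mulVf// gt_eqF.
have a0 : 0 < a ^+ 2 by rewrite exprn_gt0// invr_gt0 sqrtr_gt0.
have := unit_case z (toC a *: u) hz; rewrite frobZ a2 => /(_ erefl).
by rewrite qf_scale -(ler_pM2r f0) [leRHS]mulrAC a2 mul1r.
Qed.

End Coercivity.

(** * Compactness, continuity and attainment of the maximum *)

Section Existence.
Variable R : realType.
Local Notation C := R[i].
Local Open Scope classical_set_scope.
Variables (n m N : nat) (G : C -> 'M[C]_(n, m)) (W : C -> 'M[C]_m).
Hypotheses (lG : lipM G) (lW : lipM W).
Hypothesis uW : forall z, onT z -> W z \in unitmx.
Variable Phi0 : C -> 'M[C]_m.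
Hypothesis sPhi0 : spec_density Phi0.
Hypothesis mPhi0 : circ_intmx (fun z => G z *m Phi0 z *m ctr (G z)) = 1%:M.
Local Notation nu := N.+2.
Local Notation Mn := (Mnu nu G W).

Lemma in_QG_one : in_QG G 1%:M.
Proof.
have [bP hP] := spec_density_bmM sPhi0.
by apply/in_QGP; exists Phi0; split.
Qed.

Lemma coord_le_norm K (v : 'rV[R]_K) k : `|v 0 k| <= `|v|.
Proof.
rewrite [leRHS]/Num.norm /= mx_normrE.
exact: (le_bigmax _ (fun ij : 'I_1 * 'I_K => `|v ij.1 ij.2|) (0, k)).
Qed.

Section Coordinates.
Variables (K : nat) (E : 'I_K -> 'M[C]_n).
Hypothesis hE : forall k, in_QG G (E k).

Lemma in_QG_comb x : in_QG G (comb E x).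
Proof. exact: in_QG_sum. Qed.

Lemma combB x y : comb E y - comb E x = comb E (y - x).
Proof.
rewrite /comb -sumrB; apply: eq_bigr => k _.
rewrite !mxE toCD scalerDl; congr (_ + _).
by rewrite -scaleNr; congr (_ *: _); apply/eqP; rewrite eq_complex /= oppr0 !eqxx.
Qed.

Lemma combZ (a : R) x : comb E (a *: x) = toC a *: comb E x.
Proof.
rewrite /comb scaler_sumr; apply: eq_bigr => k _.
by rewrite mxE toCM scalerA.
Qed.

Lemma comb0 : comb E 0 = 0.
Proof.
rewrite /comb big1// => k _; rewrite mxE.
by rewrite (_ : toC 0 = 0)// scale0r.
Qed.

Lemma frob_pull_comb : exists2 B : R, 0 <= B & forall y, `|y| <= 1 ->
  forall z, onT z -> frob (pull G W (comb E y) z) <= B.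
Proof.
have /choice[b hb] : forall k, exists b : R, 0 <= b /\ forall z, onT z -> forall i j,
    `|complex.Re (pull G W (E k) z i j)| <= b /\
    `|complex.Im (pull G W (E k) z i j)| <= b.
  move=> k; have [b b0 h] := bounded_bmM (bmM_pull lG lW (E k)).
  by exists b.
pose B := \sum_k b k.
exists ((2 * B ^+ 2) *+ (m * m)).
  by rewrite mulrn_wge0// mulr_ge0// sqr_ge0.
move=> y y1 z hz; apply: frob_bound => i j.
have -> : pull G W (comb E y) z i j = \sum_k toC (y 0 k) * pull G W (E k) z i j.
  rewrite /pull /comb mulmx_sumr mulmx_suml summxE; apply: eq_bigr => k _.
  by rewrite -scalemxAr -scalemxAl mxE.
have yk k : `|y 0 k| <= 1 by exact: le_trans (coord_le_norm _ _) y1.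
split.
  rewrite Re_sum; apply: le_trans (ler_norm_sum _ _ _) _; apply: ler_sum => k _.
  rewrite ReZ normrM; have [b0 /(_ z hz i j)[h _]] := hb k.
  by apply: le_trans (ler_pM _ _ (yk k) h) _ => //; rewrite mul1r.
have -> : complex.Im (\sum_k toC (y 0 k) * pull G W (E k) z i j) =
          \sum_k y 0 k * complex.Im (pull G W (E k) z i j).
  elim/big_rec2: _ => // k a c _ <-; case: (pull _ _ _ _ _ _) c => [p q] [p' q'] /=.
  by rewrite mul0r addr0.
apply: le_trans (ler_norm_sum _ _ _) _; apply: ler_sum => k _.
rewrite normrM; have [b0 /(_ z hz i j)[_ h]] := hb k.
by apply: le_trans (ler_pM _ _ (yk k) h) _ => //; rewrite mul1r.
Qed.

Variables (r d : R).
Hypotheses (r0 : 0 < r) (d0 : 0 < d).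

(** A compact substitute for the open domain, in coordinates: a box cut by the closed condition of
    uniform positivity. *)
Definition feasible : set 'rV[R]_K :=
  [set x : 'rV[R]_K | (forall k, `|x 0 k| <= r) /\ geT N G W d (comb E x)].

Lemma bounded_feasible : bounded_set feasible.
Proof.
exists r; split; first exact: num_real.
move=> M rM x [hx _]; apply: le_trans (ltW rM).
rewrite [leLHS]/Num.norm /= mx_normrE; apply/bigmax_leP; split; first exact: ltW.
by move=> [i k] _ /=; rewrite (ord1 i).
Qed.

Lemma closed_feasible : closed feasible.
Proof.
(* The index set of all defining inequalities: one for each coordinate and one for each pair of a
   circle point and a vector, each a Lipschitz function being nonnegative. *)
pose T := ('I_K + C * 'cV[C]_m)%type.
pose f (i : T) (x : 'rV[R]_K) : R := match i with
  | inl k => r - `|x 0 k|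
  | inr zu => frob zu.2 + nu%:R^-1 * \sum_k x 0 k * qf (pull G W (E k) zu.1) zu.2
              - d * frob zu.2 end.
pose D : set T := [set i | match i with inl _ => True | inr zu => onT zu.1 end].
have -> : feasible = \bigcap_(i in D) (f i @^-1` [set y | 0 <= y]).
  apply/seteqP; split=> x.
    move=> [h1 h2] [k _|[z u] /= hz] /=; first by rewrite subr_ge0.
    by rewrite subr_ge0 -qf_Mnu_comb; exact: h2.
  move=> h; split=> [k|z hz u].
    by have := h (inl k) Logic.I; rewrite /= subr_ge0.
  by have := h (inr (z, u)) hz; rewrite /= subr_ge0 -qf_Mnu_comb.
apply: closed_bigI => i _; apply: preimage_closed; last exact: closed_ge.
suff [c hc] : exists c, forall x y, `|f i x - f i y| <= c * `|x - y|.
  by move=> x _; exact: (lipschitz_continuous hc).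
case: i => [k|[z u]].
  exists 1 => x y; rewrite mul1r /f opprB addrC subrKA.
  apply: le_trans (ler_dist_dist _ _) _; rewrite distrC.
  by have := coord_le_norm (x - y) k; rewrite !mxE.
exists (\sum_k `|qf (pull G W (E k) z) u|) => x y; rewrite /f.
rewrite opprB addrA subrK opprD addrACA subrr add0r -mulrBr -sumrB normrM.
have i1 : `|nu%:R^-1| <= 1 :> R by rewrite ger0_norm ?invr_ge0// invf_le1// ler1n.
apply: le_trans (ler_piMl (normr_ge0 _) i1) _.
apply: le_trans (ler_norm_sum _ _ _) _; rewrite mulr_suml; apply: ler_sum => k _.
rewrite -mulrBl normrM mulrC ler_wpM2l//.
by have := coord_le_norm (x - y) k; rewrite !mxE.
Qed.

(** The tangent majorant and the quadratic minorant at [x] squeeze the functional, so no limit is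
    taken under the integral sign. *)
Lemma continuous_Jnu :
  {within feasible, continuous (fun x => Jnu nu G W (comb E x))}.
Proof.
apply/subspace_continuousP => x Sx; apply/cvgrPdist_le => /= e e0.
have [c c0 hc] := Jnu_lower N lG lW d0.
have [B B0 hB] := frob_pull_comb.
pose A := \sum_k `|rtr (E k *m Dnu N G W (comb E x))|.
have A0 : 0 <= A by exact: sumr_ge0.
have T0 : 0 < A + c * B + 1 by rewrite ltr_pwDr// addr_ge0// mulr_ge0.
suff H : \forall y \near nbhs x, feasible y ->
    `|Jnu nu G W (comb E x) - Jnu nu G W (comb E y)| <= e by exact: H.
near=> y => Sy.
have [_ gx] := Sx; have [_ gy] := Sy.
have [px py] := (geT_posT d0 gx, geT_posT d0 gy).
have h1 : `|x - y| <= 1 by near: y; exact: cvgr_dist_le.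
have h2 : `|x - y| <= e / (A + c * B + 1).
  by near: y; apply: cvgr_dist_le; rewrite ?divr_gt0.
have up := Jnu_concave lG lW (in_QG_comb x) (in_QG_comb y) px py.
have lo := hc _ _ (in_QG_comb x) (in_QG_comb y) gx gy.
rewrite combB in up lo.
have linE : `|rtr (comb E (y - x) *m Dnu N G W (comb E x))| <= A * `|x - y|.
  rewrite /comb mulmx_suml rtr_sum; apply: le_trans (ler_norm_sum _ _ _) _.
  rewrite mulr_suml; apply: ler_sum => k _.
  rewrite -scalemxAl rtrZ normrM mulrC ler_wpM2l//.
  by rewrite (distrC x); exact: coord_le_norm.
(* The term is quadratic in [y - x]; for [|x - y| <= 1] it is bounded linearly, after rescaling to
   the unit ball. *)
have quadE : circ_intR (fun z => frob (pull G W (comb E (y - x)) z)) <= B * `|x - y|.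
  apply: circ_intR_le; first by apply: bmR_frob; exact: bmM_pull.
  move=> z hz; set h := `|x - y| in h1 h2 *.
  have [hh|hh] := eqVneq h 0.
    have -> : y - x = 0 by apply/eqP; rewrite -normr_eq0 distrC; apply/eqP; exact: hh.
    by rewrite comb0 /pull mulmx0 mul0mx frob0 hh mulr0.
  have hp : 0 < h by rewrite lt_def hh normr_ge0.
  pose v := h^-1 *: (y - x).
  have v1 : `|v| <= 1.
    by rewrite normrZ ger0_norm ?invr_ge0 ?normr_ge0// distrC mulVf.
  have -> : y - x = h *: v by rewrite scalerA mulfV// scale1r.
  rewrite combZ pullZ frobZ mulrC expr2; apply: ler_pM => //.
  - exact: frob_ge0.
  - exact: mulr_ge0 (ltW hp) (ltW hp).
  - exact: hB.
  - by rewrite ler_piMl// ltW.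
move: linE up lo; rewrite ler_norml.
move: (rtr _) (circ_intR _) quadE => lin quad quadE /andP[l1 l2].
move: (Jnu _ _ _ (comb E x)) (Jnu _ _ _ (comb E y)) => Jx Jy up lo.
have cq : c * quad <= c * B * `|x - y| by rewrite -mulrA ler_wpM2l.
have : (A + c * B + 1) * `|x - y| <= e by rewrite mulrC -ler_pdivlMr.
rewrite mulrDl mulrDl mul1r => tot.
have cBh : 0 <= c * B * `|x - y| by rewrite mulr_ge0// mulr_ge0.
have hh := normr_ge0 (x - y).
rewrite ler_norml; apply/andP; split; lra.
Unshelve. all: by end_near.
Qed.

End Coordinates.

Theorem dual_optimum : exists L0, [/\ in_QG G L0, posT N G W L0,
  (forall L, in_QG G L -> posT N G W L -> Jnu nu G W L <= Jnu nu G W L0) &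
  Dnu N G W L0 = 0].
Proof.
have [K [E [hE basisE]]] := QG_basis lG.
have [r [d [r0 d0 hS]]] := superlevel_bounds N lG lW uW sPhi0 mPhi0 hE basisE.
(* [M(0)] is the identity, so lowering the constant to at most 1 makes the origin feasible while the
   superlevel set stays inside. *)
pose d' := Num.min d 1.
have d'0 : 0 < d' by rewrite lt_min d0 ltr01.
have F0 : feasible E r d' 0.
  split=> [k|z hz u]; first by rewrite mxE normr0 ltW.
  rewrite qf_Mnu_comb big1 ?mulr0 ?addr0 => [|k _]; last by rewrite mxE mul0r.
  by rewrite ler_piMl ?frob_ge0// ge_min lexx orbT.
have Fne : feasible E r d' !=set0 by exists 0.
have Fc : compact (feasible E r d').
  by apply: bounded_closed_compact; [exact: bounded_feasible|exact: closed_feasible].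
have cJ : {within feasible E r d', continuous (fun x => Jnu nu G W (comb E x))}.
  exact: continuous_Jnu.
have [x0 x0F maxx] := EVT_max_rV Fne Fc cJ.
rewrite inE in x0F; have [_ gx0] := x0F.
have hL0 := in_QG_comb hE x0; have pL0 := geT_posT d'0 gx0.
have maxL L : in_QG G L -> posT N G W L -> Jnu nu G W L <= Jnu nu G W (comb E x0).
  (* A competitor below the level of the origin loses to the origin, which is feasible; any other
     lies in the superlevel set and is itself feasible. *)
  move=> hL pL; have [sL|/ltW sL] := leP (Jnu nu G W 0) (Jnu nu G W L); last first.
    by apply: le_trans sL _; rewrite -(comb0 E); apply: maxx; rewrite inE.
  have [h1 h2] := hS L (And3 hL pL sL).
  rewrite (comb_coord basisE hL); apply: maxx; rewrite inE; split.
    by move=> k; rewrite mxE.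
  rewrite -(comb_coord basisE hL) => z hz u; apply: le_trans (h2 z hz u).
  by rewrite ler_wpM2r ?frob_ge0// ge_min lexx.
exists (comb E x0); split=> //.
exact: (first_order lG lW in_QG_one d'0 hL0 gx0 maxL).
Qed.

End Existence.

(** * Regularity of the rational data on the circle, and the theorem *)

Section RationalData.
Variable R : realType.
Local Notation C := R[i].

Lemma unitmx_resolvent n (A : 'M[C]_n) (z : C) :
  (forall lam, eigenvalue A lam -> `|lam| < 1) -> onT z -> z%:M - A \in unitmx.
Proof.
move=> hA hz; apply: contraT => nu.
have /hA : eigenvalue A z.
  rewrite /eigenvalue /eigenspace kermx_eq0 row_free_unit.
  by rewrite -opprB -scaleN1r unitmxZ// unitrN unitr1.
by rewrite hz ltxx.
Qed.

Lemma lipM_scalar n : lipM (fun z : C => (z%:M : 'M[C]_n)).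
Proof.
move=> i j; under eq_fun do rewrite mxE.
by case: (i == j); [exact: lipT_id|exact: lipT_cst].
Qed.

Lemma lipM_Gfun n m (S A : 'M[R]_n) (B : 'M[R]_(n, m)) :
  (forall lam : C, eigenvalue (map_mx (@toC R) A) lam -> `|lam| < 1) ->
  lipM (Gfun S A B).
Proof.
move=> hA; apply: lipM_mul; last exact: lipM_cst.
apply: lipM_mul; first exact: lipM_cst.
apply: lipM_inv; last by move=> z; exact: unitmx_resolvent.
by apply: lipM_add; [exact: lipM_scalar|exact: lipM_cst].
Qed.

Lemma onT_ge1 (z : C) : onT z -> 1 <= `|z|.
Proof. by move=> ->. Qed.

Lemma lipM_ratmx k (N : 'M[{poly C}]_k) (d : {poly C}) :
  canonical_factor N d -> lipM (ratmx_eval N d).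
Proof.
move=> [d0 _ _ _ _] i j; under eq_fun do rewrite mxE.
apply: lipTM; first exact: lipT_horner.
by apply: lipT_inv; [exact: lipT_horner|move=> z /onT_ge1; exact: d0].
Qed.

Lemma unitmx_ratmx k (N : 'M[{poly C}]_k) (d : {poly C}) (z : C) :
  canonical_factor N d -> onT z -> ratmx_eval N d z \in unitmx.
Proof.
by move=> [_ _ det0 _ _] /onT_ge1 /det0; rewrite unitmxE unitfE.
Qed.

End RationalData.

Theorem theorem1 (R : realType) (n m nu : nat)
    (A : 'M[R]_n) (B : 'M[R]_(n, m)) (Sigma Shalf : 'M[R]_n)
    (N : 'M[{poly R[i]}]_m) (d : {poly R[i]}) :
  (1 < nu)%N ->
  (m < n)%N ->
  (forall lam : R[i], eigenvalue (map_mx (@toC R) A) lam -> `|lam| < 1) ->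
  \rank B = m ->
  reachable A B ->
  rposdef Sigma ->
  rposdef Shalf -> Shalf *m Shalf *m Sigma = 1%:M ->
  canonical_factor N d ->
  spec_density (fun z => ratmx_eval N d z *m ctr (ratmx_eval N d z)) ->
  let G := Gfun Shalf A B in
  let W := ratmx_eval N d in
  (exists Phi, spec_density Phi /\ circ_intmx (fun z => G z *m Phi z *m ctr (G z)) = 1%:M) ->
  exists L0 : 'M[R[i]]_n,
    [/\ Lplus nu G W L0,
        (forall L, Lplus nu G W L -> Jnu nu G W L <= Jnu nu G W L0),
        (forall L, Lplus nu G W L ->
           (forall L', Lplus nu G W L' -> Jnu nu G W L' <= Jnu nu G W L) -> L = L0) &
        circ_intmx (fun z => G z *m Phinu nu G W L0 z *m ctr (G z)) = 1%:M].
Proof.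
case: nu => [|[|k]]// _ _ hA _ _ _ _ _ hN _ G W [Phi [sPhi mPhi]].
have lG : lipM G by exact: lipM_Gfun.
have lW : lipM W by exact: lipM_ratmx.
have uW z : onT z -> W z \in unitmx by exact: unitmx_ratmx.
have [L0 [hL0 pL0 maxL0 D0]] := dual_optimum k lG lW uW sPhi mPhi.
have L0P : Lplus k.+2 G W L0 by apply/LplusP.
exists L0; split.
- exact: L0P.
- by move=> L /(LplusP _ _ lG)[hL pL]; exact: maxL0.
- move=> L LP maxL; have /(LplusP _ _ lG)[hL pL] := LP.
  (* A second maximizer satisfies [J(L0) <= J(L)], which at the critical point [L0] forces
     equality. *)
  exact: (critical_unique lG lW uW hL0 hL pL0 pL D0 (maxL _ L0P)).
- exact: subr0_eq D0.
Qed.
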